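(* Let $n \ge 1$. The generating function (sum of weights) of all arrowed monotone triangles with bottom row $0,2,\ldots,2n-2$ is equal to the generating function of all pairs $(P,Q)$ of plane partitions of the same shape with $n$ rows (allowing also rows of length zero) such that - $P$ is a column-strict plane partition and $Q$ is a row-strict plane partition, and - for each $i=1,\ldots,n$, the entries of $P$ in the $i$-th row from the bottom are no greater than $2i$, and the entries of $Q$ in the $i$-th row from the bottom are no greater than $i$, where the weight of a pair $(P,Q)$ is $$w^{\binom{n+1}{2}-\#\text{ of entries in }P} \prod_{i=1}^{n} X_i^{n-1} (u X_i)^{\#\text{ of } 2i-1 \text{ in } P} (v X_i^{-1})^{\#\text{ of } 2i\text{ in }P}.$$
   Context: $u,v,w,X_1,\ldots,X_n$ are indeterminates. **Monotone triangles.** A monotone triangle with $n$ rows is a triangular array of integers $(m_{i,j})_{1\le j\le i\le n}$ (row $i$ is $m_{i,1},\ldots,m_{i,i}$; rows are displayed centered, row $1$ on top) with $m_{i+1,j}\le m_{i,j}\le m_{i+1,j+1}$ and $m_{i,j}<m_{i,j+1}$ whenever the entries exist. The $\nwarrow$-neighbor of $m_{i,j}$ is $m_{i-1,j-1}$ and its $\nearrow$-neighbor is $m_{i-1,j}$ (if they exist). The bottom row is row $n$. **Arrowed monotone triangles (AMTs).** An AMT is a monotone triangle in which each entry carries exactly one of three decorations: $\nwarrow$, $\nearrow$, or the double arrow $\nwarrow\!\nearrow$, such that: (i) if an entry $e$ has a $\nwarrow$-neighbor and is equal to it, then $e$ carries $\nearrow$; (ii) if $e$ has a $\nearrow$-neighbor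 and is equal to it, then $e$ carries $\nwarrow$. The weight of an AMT with $n$ rows is $$u^{\#\nearrow}v^{\#\nwarrow}w^{\#\nwarrow\!\nearrow}\prod_{i=1}^n X_i^{(\text{sum of entries in row }i)-(\text{sum of entries in row }i-1)+(\#\nearrow\text{ in row }i)-(\#\nwarrow\text{ in row }i)},$$ where the sum of row $0$ is $0$, and $\#\nearrow$, $\#\nwarrow$, $\#\nwarrow\!\nearrow$ count the entries carrying exactly that decoration (an entry with the double arrow is counted only in $\#\nwarrow\!\nearrow$). **Plane partitions.** A column-strict plane partition is a filling of a Young diagram (English notation) with positive integers that weakly decrease along rows and strictly decrease down columns. A row-strict plane partition is a filling of a Young diagram with positive integers that strictly decrease along rows and weakly decrease down columns. The shape is regarded as a partition $\lambda_1\ge\cdots\ge\lambda_n\ge 0$ with exactly $n$ (possibly zero) parts, so the $i$-th row from the bottom is the row of length $\lambda_{n+1-i}$. *)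

(* Defs.v *)
From HB Require Import structures.
From mathcomp Require Import all_boot all_order all_algebra.
From mathcomp Require Import mpoly.

Set Implicit Arguments.
Unset Strict Implicit.
Unset Printing Implicit Defensive.

Import Order.TTheory GRing.Theory Num.Theory.
Local Open Scope ring_scope.

(* Left-justified arrays with n rows, r i being the length of row i.  Rows and
   columns are numbered from 0, top to bottom and left to right; both monotone
   triangles and fillings of Young diagrams (English notation) are functions on
   such cells. *)
Definition cells (n : nat) (r : 'I_n -> nat) : Type := {i : 'I_n & 'I_(r i)}.
HB.instance Definition _ n (r : 'I_n -> nat) := Finite.on (cells r).

Definition row n (r : 'I_n -> nat) (c : cells r) : nat := tag c.
Definition col n (r : 'I_n -> nat) (c : cells r) : nat := tagged c.

(** * Arrowed monotone triangles *)

Notation triangle n := (cells (fun i : 'I_n => i.+1)).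

Inductive arrow := NW | NE | NWNE.

Definition arrow_code (a : arrow) : option bool :=
  match a with NW => Some true | NE => Some false | NWNE => None end.
Definition arrow_decode (x : option bool) : arrow :=
  match x with Some true => NW | Some false => NE | None => NWNE end.
Lemma arrow_codeK : cancel arrow_code arrow_decode.
Proof. by case. Qed.
HB.instance Definition _ := Finite.copy arrow (can_type arrow_codeK).

Section MonotoneTriangles.
Variable n : nat.
Implicit Types (c d : triangle n) (m : triangle n -> int)
  (a : triangle n -> arrow).

Definition nw_neighbor c d : bool :=
  (row c == (row d).+1) && (col c == (col d).+1).
Definition ne_neighbor c d : bool :=
  (row c == (row d).+1) && (col c == col d).

Definition monotone_triangle m : bool :=
  [&& [forall c, forall d, ne_neighbor c d ==> (m c <= m d)],
      [forall c, forall d, nw_neighbor c d ==> (m d <= m c)]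
    & [forall c, forall d,
         (row c == row d) && (col d == (col c).+1) ==> (m c < m d)]].

Definition bottom_row (k : nat -> int) m : bool :=
  [forall c, ((row c).+1 == n) ==> (m c == k (col c))].

Definition arrowed m a : bool :=
  [forall c, forall d, nw_neighbor c d && (m d == m c) ==> (a c == NE)] &&
  [forall c, forall d, ne_neighbor c d && (m d == m c) ==> (a c == NW)].

Definition is_amt m a : bool := monotone_triangle m && arrowed m a.

(* Here rows are counted from 1, so that row_sum m 0 = 0. *)
Definition row_sum m (k : nat) : int := \sum_(c | (row c).+1 == k) m c.

Definition arrow_count a (x : arrow) : nat := #|[set c | a c == x]|.
Definition row_arrow_count a (x : arrow) (k : nat) : nat :=
  #|[set c | ((row c).+1 == k) && (a c == x)]|.

Definition amt_weight (R : comUnitRingType) (u v w : R) (X : 'I_n -> R) m a : R :=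
  u ^+ arrow_count a NE * v ^+ arrow_count a NW * w ^+ arrow_count a NWNE *
  \prod_(i < n) X i ^ (row_sum m i.+1 - row_sum m i
                       + (row_arrow_count a NE i.+1)%:Z
                       - (row_arrow_count a NW i.+1)%:Z).

Definition even_bottom (j : nat) : int := (2 * j)%N%:Z.

(* The type 'I_n.*2 of the entries is no restriction: see even_bottom_bound. *)
Definition amt_gf (R : comUnitRingType) (u v w : R) (X : 'I_n -> R) : R :=
  \sum_(m : {ffun triangle n -> 'I_n.*2})
  \sum_(a : {ffun triangle n -> arrow} |
          is_amt (fun c => (m c : nat)%:Z) a
          && bottom_row even_bottom (fun c => (m c : nat)%:Z))
     amt_weight u v w X (fun c => (m c : nat)%:Z) a.

Lemma even_bottom_bound m : monotone_triangle m -> bottom_row even_bottom m ->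
  forall c, (0 <= m c) && (m c < n.*2%:Z).
Proof.
case/and3P=> /forallP hne /forallP hnw _ /forallP hb.
suff H k : forall c, (n - (row c).+1 = k)%N ->
    ((2 * col c)%N%:Z <= m c) && (m c < n.*2%:Z).
  move=> c; have /andP[h ->] := H _ c erefl.
  by rewrite andbT (le_trans _ h).
elim: k => [|k IH] c hk.
  have hr : (row c).+1 == n.
    by rewrite eqn_leq ltn_ord /= -subn_eq0 hk.
  have hc : (col c < (row c).+1)%N by rewrite /row /col ltn_ord.
  have /eqP -> := implyP (hb c) hr; rewrite lexx ltz_nat -muln2 mulnC.
  by rewrite ltn_pmul2r // (leq_trans hc) // (eqP hr).
have hr : ((row c).+1 < n)%N by rewrite -subn_gt0 hk.
have hc : (col c <= row c)%N by rewrite -ltnS /row /col ltn_ord.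
pose cell (j : nat) (hj : (j < (row c).+2)%N) : triangle n :=
  @Tagged _ (Ordinal hr) (fun i : 'I_n => 'I_i.+1) (Ordinal hj).
have kP : (n - (row c).+2 = k)%N by rewrite subnS hk.
have /andP[lo _] := IH (cell _ (leqW hc : (col c < (row c).+2)%N)) kP.
have /andP[_ hi] := IH (@cell (col c).+1 hc) kP.
have e1 := implyP (forallP (hne (cell _ (leqW hc : (col c < (row c).+2)%N))) c).
have e2 := implyP (forallP (hnw (@cell (col c).+1 hc)) c).
apply/andP; split.
  by apply: le_trans lo (e1 _); rewrite /ne_neighbor !eqxx.
by apply: le_lt_trans (e2 _) hi; rewrite /nw_neighbor !eqxx.
Qed.

End MonotoneTriangles.

(** * Plane partitions *)

Definition is_partition (n : nat) (lam : 'I_n -> nat) : bool :=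
  [forall i : 'I_n, forall j : 'I_n, (i <= j)%N ==> (lam j <= lam i)%N].

Section PlanePartitions.
Variables (n : nat) (lam : 'I_n -> nat).
Implicit Types (c d : cells lam) (P Q : cells lam -> nat).

Definition column_strict P : bool :=
  [&& [forall c, (0 < P c)%N],
      [forall c, forall d,
         (row c == row d) && (col c < col d)%N ==> (P d <= P c)%N]
    & [forall c, forall d,
         (col c == col d) && (row c < row d)%N ==> (P d < P c)%N]].

Definition row_strict Q : bool :=
  [&& [forall c, (0 < Q c)%N],
      [forall c, forall d,
         (row c == row d) && (col c < col d)%N ==> (Q d < Q c)%N]
    & [forall c, forall d,
         (col c == col d) && (row c < row d)%N ==> (Q d <= Q c)%N]].

(* Counted from 1: the last of the n rows is the first from the bottom. *)
Definition row_from_bottom c : nat := n - row c.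

Definition is_pp_pair P Q : bool :=
  [&& column_strict P, row_strict Q,
      [forall c, (P c <= 2 * row_from_bottom c)%N]
    & [forall c, (Q c <= row_from_bottom c)%N]].

Definition entry_count P (x : nat) : nat := #|[set c | P c == x]|.

(* The product runs over i = 0, ..., n-1, hence the shift from 2i-1 and 2i. *)
Definition pp_weight (R : comUnitRingType) (u v w : R) (X : 'I_n -> R) P : R :=
  w ^ ('C(n.+1, 2)%:Z - #|{: cells lam}|%:Z) *
  \prod_(i < n) (X i ^+ n.-1 * (u * X i) ^+ entry_count P (2 * i).+1
                             * (v * (X i)^-1) ^+ entry_count P (2 * i).+2).

Lemma pp_pair_shape_bound P Q : is_pp_pair P Q -> forall i, (lam i <= n)%N.
Proof.
case/and4P=> _ /and3P[/forallP pos /forallP str _] _ /forallP bnd i.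
pose cell (j : 'I_(lam i)) : cells lam := @Tagged _ i (fun i => 'I_(lam i)) j.
suff H (j : nat) (hj : (j < lam i)%N) : (Q (cell (Ordinal hj)) + j <= n)%N.
  case: (posnP (lam i)) => [-> //|lam0].
  have hj : ((lam i).-1 < lam i)%N by rewrite prednK.
  apply: leq_trans (H _ hj); rewrite -{1}(prednK lam0) -add1n leq_add2r.
  exact: pos.
elim: j hj => [|j IH] hj.
  by rewrite addn0 (leq_trans (bnd _)) // leq_subr.
apply: leq_trans (IH (ltnW hj)); rewrite addnS -addSn leq_add2r.
by apply: (implyP (forallP (str _) _)); rewrite /row /col /= eqxx ltnSn.
Qed.

End PlanePartitions.

(* The parts of the shape are at most n by pp_pair_shape_bound, and the entries
   of P and Q are at most 2n and n by definition of is_pp_pair, so that the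
   finite types below are no restriction. *)
Definition pp_gf (n : nat) (R : comUnitRingType) (u v w : R) (X : 'I_n -> R) : R :=
  \sum_(lam : {ffun 'I_n -> 'I_n.+1} | is_partition (fun i => lam i))
  \sum_(P : {ffun cells (fun i => lam i) -> 'I_(2 * n).+1})
  \sum_(Q : {ffun cells (fun i => lam i) -> 'I_n.+1} |
          is_pp_pair (fun c => P c) (fun c => Q c))
     pp_weight u v w X (fun c => P c).

(** * Indeterminates *)

(* Laurent polynomials in u, v, w, X_1, ..., X_n with integer coefficients are
   taken in the field of fractions of the polynomial ring. *)
Definition ratfun (n : nat) : fieldType := {fraction {mpoly int[3 + n]}}.

Definition indet (n : nat) (i : 'I_(3 + n)) : ratfun n :=
  tofrac ('X_i : {mpoly int[3 + n]}).

Definition uvar (n : nat) : ratfun n := indet (lshift n (@Ordinal 3 0 isT)).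
Definition vvar (n : nat) : ratfun n := indet (lshift n (@Ordinal 3 1 isT)).
Definition wvar (n : nat) : ratfun n := indet (lshift n (@Ordinal 3 2 isT)).
Definition Xvar (n : nat) (i : 'I_n) : ratfun n := indet (rshift 3 i).

(* Main.v *)
Require Import Defs.
From mathcomp Require Import all_boot all_order all_algebra all_fingroup.
From mathcomp Require Import mpoly ring zify.
From Stdlib Require Import FunctionalExtensionality.

(** Put [t_j = u X_j], [t'_j = v / X_j], [c_j = t_j + t'_j], [a_j = t_j (w + t_j)]
    and [a'_j = t'_j (w + t'_j)].  Multiplied by
    [prod_j (t_j - t'_j) * prod_(i < j) (c_j - c_i)], both generating functions
    become [prod_j X_j^(n-1) * det (a_j^i - a'_j^i)], where [1 <= i, j <= n]; the
    multiplier is nonzero for indeterminates.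

    Arrowed monotone triangles.  For every strictly increasing bottom row [k],
    the generating function is a product times an antisymmetrizer divided by the
    Vandermonde product of the [X_j] ([amt_operator_formula]).  This goes by
    induction on the number of rows: once the arrows of the bottom row are
    fixed, each entry of the row above it ranges over an interval of its own, so
    that the sum over that row is a product of geometric sums.  Each of them
    contributes its lower or its upper endpoint, and a choice of endpoints is
    cancelled by antisymmetry unless all lower endpoints come first
    ([operator_sum_recurrence]).  For [k = (0, 2, ..., 2n-2)] the identity
    [(t_q - t'_p) (t_q + t'_p + w) = a_q - a'_p] turns the antisymmetrizer into
    the one of [prod_(p <= q) (a_q - a'_p)], which is the determinant above
    ([antisym_prod_sub]).

    Plane partitions.  For a fixed shape [lam], put
    [L_i = lam_i + n + 1 - i].  Removing the entries 1 and 2 of [P] takes away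
    two horizontal strips and leaves the same problem with one row and one
    variable less; the resulting recurrence is solved by the symplectic
    bialternant [det (t_j^(L_i) - t'_j^(L_i))] ([symplectic_fill_sum]).
    Removing the entries 1 of [Q] takes away a vertical strip.  Summed over all
    shapes against a determinant [det (phi_j(L_i))], such a removal replaces
    [phi(e)] by [w phi(e + 1) + phi(e + 2)] and splits off one row of the
    determinant ([sum_vstrip_sum_det]).  For [phi_j(e) = t_j^e - t'_j^e] this
    operation multiplies [t_j^e] by [a_j] and [t'_j^e] by [a'_j], so that the same
    determinant comes out with its rows in reverse order. *)

Set Implicit Arguments.
Unset Strict Implicit.
Unset Printing Implicit Defensive.

Import Order.TTheory GRing.Theory Num.Theory.
Local Open Scope ring_scope.

(** * Antisymmetrizers and determinants *)

Lemma reindex_lift_perm (V : zmodType) n (i0 j0 : 'I_n.+1) (F : 'S_n.+1 -> V) :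
  \sum_(s : 'S_n.+1 | s i0 == j0) F s = \sum_(s : 'S_n) F (lift_perm i0 j0 s).
Proof.
pose ulsf i (s : 'S_n.+1) k := odflt k (unlift (s i) (s (lift i k))).
have ulsfK i (s : 'S_n.+1) k : lift (s i) (ulsf i s k) = s (lift i k).
  rewrite /ulsf; have := neq_lift i k.
  by rewrite -(can_eq (permK s)) => /unlift_some[] ? ? ->.
have inj_ulsf : injective (ulsf i0 _).
  move=> s; apply: can_inj (ulsf (s i0) s^-1%g) _ => k'.
  by rewrite {1}/ulsf ulsfK !permK liftK.
rewrite (reindex (lift_perm i0 j0)); last first.
  exists (fun s => perm (inj_ulsf s)) => [s _ | s].
    by apply/permP=> k'; rewrite permE /ulsf lift_perm_lift lift_perm_id liftK.
  move/(s _ =P _) => si0; apply/permP=> k.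
  case: (unliftP i0 k) => [k'|] ->; rewrite ?lift_perm_id //.
  by rewrite lift_perm_lift -si0 permE ulsfK.
by apply: eq_bigl => s; rewrite lift_perm_id eqxx.
Qed.

Lemma sign_lift_perm (R : pzRingType) n (i j : 'I_n.+1) (s : 'S_n) :
  (-1) ^+ (lift_perm i j s) = (-1) ^+ (i + j) * (-1) ^+ s :> R.
Proof.
by rewrite odd_lift_perm !signr_addb exprD -(signr_odd R i) -(signr_odd R j).
Qed.

(** Induction on [n] by the value [s ord_max = k]: the factors with [q] maximal
    multiply to [f(a_k)] with [f = prod_p ('X - b_p)], whatever the rest of [s]
    is.  So the sum is the determinant with last row [f(a_k)].  As [f(b_k) = 0],
    this row is [f(a_k) - f(b_k)], a combination of the rows
    [a_k^i - b_k^i] in which the last one has coefficient 1. *)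
Lemma antisym_prod_sub (R : comNzRingType) n (a b : 'I_n -> R) :
  \sum_(s : 'S_n) (-1) ^+ s *
     \prod_(q < n) \prod_(p < n | (p <= q)%N) (a (s q) - b (s p))
  = \det (\matrix_(i, j) (a j ^+ i.+1 - b j ^+ i.+1)).
Proof.
elim: n a b => [|n IH] a b.
  rewrite det_mx00 (big_pred1 1%g) => [|s]; last first.
    by apply/esym/eqP/permP => -[].
  by rewrite big_ord0 odd_perm1 mulr1.
set M := (\matrix_(i, j) _).
pose f : {poly R} := \prod_(p < n.+1) ('X - (b p)%:P).
have sf : size f = n.+2 by rewrite size_prod_XsubC /index_enum -enumT size_enum_ord.
have f1 : f`_n.+1 = 1.
  have /monicP : f \is monic by apply: monic_prod_XsubC.
  by rewrite lead_coefE sf.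
(* Multiplication by [U] changes the last row into [f(a_j) - f(b_j) = f(a_j)]. *)
pose U : 'M[R]_n.+1 := \matrix_(i, j) if i == ord_max then f`_j.+1 else (i == j)%:R.
have detU : \det U = 1.
  rewrite det_trig; last first.
    apply/is_trig_mxP => i j lij; rewrite mxE; case: eqP => [ei|_].
      by move: lij; rewrite ei ltnNge -ltnS ltn_ord.
    by case: eqP lij => // ->; rewrite ltnn.
  by apply: big1 => i _; rewrite mxE; case: eqP => [->|_]; rewrite ?f1 ?eqxx.
have UM i j : (U *m M) i j = if i == ord_max then f.[a j] else M i j.
  rewrite mxE; case: (i =P ord_max) => [ei|ni].
    have fb : f.[b j] = 0.
      by rewrite horner_prod (bigD1 j) //= !hornerE subrr mul0r.
    rewrite -[RHS]subr0 -{2}fb !horner_coef sf -sumrB [RHS]big_ord_recl.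
    rewrite [X in X + _](_ : _ = 0) ?add0r; last first.
      by rewrite !expr0 subrr.
    apply: eq_bigr => k _.
    by rewrite !mxE ei eqxx -mulrBr.
  rewrite (bigD1 i) //= big1 ?addr0; last first.
    move=> k nk; rewrite mxE; case: eqP => // _.
    by rewrite eq_sym (negbTE nk) mul0r.
  by rewrite mxE; case: eqP => // _; rewrite eqxx mul1r.
transitivity (\det (U *m M)); last by rewrite det_mulmx detU mul1r.
rewrite (expand_det_row _ ord_max).
rewrite (partition_big (fun s : 'S_n.+1 => s ord_max) predT) //=.
apply: eq_bigr => k _; rewrite reindex_lift_perm UM eqxx /cofactor.
have -> : \det (row' ord_max (col' k (U *m M))) =
    \det (\matrix_(i, j) (a (lift k j) ^+ i.+1 - b (lift k j) ^+ i.+1)).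
  congr (\det _); apply/matrixP => i j; rewrite !mxE -[\sum_ _ _]/(\sum_j _).
  have := UM (lift ord_max i) (lift k j); rewrite mxE => ->.
  by rewrite eq_sym (negbTE (neq_lift _ _)) mxE lift_max.
rewrite -(IH (fun j => a (lift k j)) (fun j => b (lift k j))) !mulr_sumr.
apply: eq_bigr => s _. rewrite sign_lift_perm.
rewrite (bigD1_ord ord_max) //= lift_perm_id.
have -> : \prod_(p < n.+1 | (p <= n)%N) (a k - b (lift_perm ord_max k s p)) = f.[a k].
  rewrite horner_prod [RHS](reindex_perm (lift_perm ord_max k s)) /=.
  by apply: eq_big => [p|p _]; rewrite ?hornerE //= -ltnS ltn_ord.
rewrite mulrCA -!mulrA; congr (_ * (_ * (_ * _))).
apply: eq_bigr => q _.
have bmax (i : 'I_n) : bump n i = i by rewrite /bump leqNgt ltn_ord.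
rewrite big_mkcond (bigD1_ord ord_max) //= bmax leqNgt ltn_ord mul1r.
rewrite [RHS]big_mkcond; apply: eq_bigr => p _.
by rewrite bmax !lift_perm_lift.
Qed.

(** * Finite functions as sequences *)

(** Partitions and rows of triangles are summed over as finite functions, but
    used as sequences padded with zeros: the neighbours at the boundary then need
    no special treatment, and dropping zero parts does not change the sequence. *)
Definition ext r N (l : {ffun 'I_r -> 'I_N}) (k : nat) : nat :=
  if insub k is Some i then l i : nat else 0%N.

Lemma ext_ord r N (l : {ffun 'I_r -> 'I_N}) (i : 'I_r) : ext l i = l i.
Proof. by rewrite /ext valK. Qed.

Lemma ext_out r N (l : {ffun 'I_r -> 'I_N}) k : (r <= k)%N -> ext l k = 0%N.
Proof. by move=> h; rewrite /ext insubF // ltnNge h. Qed.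

Lemma ext_bound r N (l : {ffun 'I_r -> 'I_N.+1}) k : (ext l k <= N)%N.
Proof. by rewrite /ext; case: insub => // i; rewrite -ltnS ltn_ord. Qed.

(** * Sums of determinants *)

(** Multilinearity of the determinant in its rows. *)
Lemma sum_box_det (R : comNzRingType) r N (P : 'I_r -> pred 'I_N)
    (c : 'I_r -> 'I_N -> R) (f : 'I_r -> 'I_r -> 'I_N -> R) :
  \sum_(m : {ffun 'I_r -> 'I_N} | [forall i, P i (m i)])
     (\prod_i c i (m i)) * \det (\matrix_(i, j) f i j (m i))
  = \det (\matrix_(i, j) \sum_(k | P i k) c i k * f i j k).
Proof.
transitivity (\sum_(s : 'S_r) (-1) ^+ s *
   \sum_(m : {ffun 'I_r -> 'I_N} | [forall i, P i (m i)])
     \prod_i (c i (m i) * f i (s i) (m i))).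
  rewrite (eq_bigr (fun s : 'S_r => 
   \sum_(m : {ffun 'I_r -> 'I_N} | [forall i, P i (m i)])
     (-1) ^+ s * \prod_i (c i (m i) * f i (s i) (m i)))); last first.
    by move=> s _; rewrite mulr_sumr.
  rewrite exchange_big; apply: eq_bigr => m _ /=.
  rewrite mulr_sumr; apply: eq_bigr => s _.
  rewrite big_split /= mulrCA; congr (_ * (_ * _)).
  by apply: eq_bigr => i _; rewrite mxE.
apply: eq_bigr => s _; congr (_ * _).
under [RHS]eq_bigr do rewrite mxE.
rewrite (bigA_distr_big_dep P); apply: eq_bigl => m.
by apply/forallP/familyP => h i; have := h i.
Qed.

(** The matrix on the left is the one on the right multiplied by a unitriangular
    matrix. *)
Lemma det_sub_next_row (R : comNzRingType) n (g : nat -> 'I_n -> R) (d : nat -> R) :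
  (forall j, g n j = 0) ->
  \det (\matrix_(i < n, j < n) (g i j - d i * g i.+1 j))
  = \det (\matrix_(i < n, j < n) g i j).
Proof.
move=> gn; pose U : 'M[R]_n := \matrix_(i, j) ((i == j)%:R - d i * (j == i.+1 :> nat)%:R).
have detU : \det U = 1.
  rewrite -det_tr det_trig.
    apply: big1 => i _; rewrite !mxE eqxx.
    by rewrite -[X in X == _]addn0 -addn1 eqn_add2l mulr0 subr0.
  apply/is_trig_mxP => i j lij; rewrite !mxE.
  by rewrite -val_eqE /= (gtn_eqF lij) (ltn_eqF (leqW lij)) mulr0 subr0.
transitivity (\det (U *m \matrix_(i < n, j < n) g i j)); last first.
  by rewrite det_mulmx detU mul1r.
congr (\det _); apply/matrixP => i j.
rewrite !mxE.
under eq_bigr do rewrite !mxE mulrBl.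
rewrite sumrB (bigD1 i) //= eqxx mul1r big1 ?addr0; last first.
  by move=> k; rewrite eq_sym => /negbTE ->; rewrite mul0r.
congr (_ - _); under eq_bigr do rewrite -mulrA.
rewrite -mulr_sumr; congr (_ * _).
have [li|] := ltnP i.+1 n.
  rewrite (bigD1 (Ordinal li)) //= eqxx mul1r big1 ?addr0 // => k.
  by rewrite -val_eqE /= => /negbTE ->; rewrite mul0r.
move=> hi; rewrite (_ : i.+1 = n); last by apply/eqP; rewrite eqn_leq hi ltn_ord.
by rewrite gn big1 // => k _; rewrite ltn_eqF ?mul0r.
Qed.

Lemma big_ord_interval {T : Type} {idx : T} {op : Monoid.law idx} {N} (f : nat -> T) {a b} :
  (b <= N)%N -> \big[op/idx]_(m < N | (a <= m < b)%N) f m = \big[op/idx]_(a <= m < b) f m.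
Proof.
move=> bN; rewrite (big_nat_widen _ _ _ _ _ bN) big_geq_mkord.
by apply: eq_bigl => m; rewrite andbC.
Qed.

(** The summand is the increment of [m |-> y^(b+1-m) * H (m + s)]. *)
Lemma sum_geometric (R : comNzRingType) N (y : R) (f H : nat -> R) a b s :
  (a <= b.+1)%N -> (b <= N)%N -> (forall e, H e.+1 - y * H e = f e) ->
  \sum_(m < N.+1 | (a <= m <= b)%N) y ^+ (b - m) * f (m + s)%N
  = H (b.+1 + s)%N - y ^+ (b.+1 - a) * H (a + s)%N.
Proof.
move=> lab lbN Hf.
under eq_bigl do rewrite -[(_ <= b)%N]ltnS.
rewrite (big_ord_interval (fun m => y ^+ (b - m) * f (m + s)%N)) //.
rewrite (telescope_sumr_eq (fun m => y ^+ (b.+1 - m) * H (m + s)%N)) //.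
  by rewrite subnn mul1r.
move=> m /andP[_ mb]; rewrite -Hf subSS (subSn (ltnSE mb)) exprSr addSn.
by rewrite mulrBr mulrA.
Qed.

(** * Symplectic bialternants *)

(** Interlacing of two partitions, looked at in the first [r] rows only. *)
Definition horizontal_strip r (l m : nat -> nat) : bool :=
  [forall i : 'I_r, (l i.+1 <= m i <= l i)%N].

(** The numerator of the symplectic character of the partition [l] with [r] parts,
    when [x' j] is the inverse of [x j]. *)
Definition bialternant (F : fieldType) r (x x' : nat -> F) (l : nat -> nat) : 'M_r :=
  \matrix_(i < r, j < r) (x j ^+ (l i + (r - i)) - x' j ^+ (l i + (r - i))).

(** Each row of the bialternant is summed over an interval.  The function [K]
    solves [K (e + 1) - z K e = x^e - x'^e], so that the sum is the difference of
    two consecutive rows of the [r + 1] by [r] matrix of the [K]; the extra column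
    of powers of [z] is killed by the same differences except in the last row,
    and makes the matrix square. *)
Lemma sum_lower_strip (F : fieldType) r N (x x' : nat -> F) (z : F) (l : nat -> nat) :
    (forall j, (j < r)%N -> x j != z) -> (forall j, (j < r)%N -> x' j != z) ->
    (forall i, (l i.+1 <= l i)%N) -> (l 0 <= N)%N ->
  z * (\sum_(m : {ffun 'I_r -> 'I_N.+1} | horizontal_strip r l (ext m))
    (\prod_(i < r.+1) z ^+ (l i - ext m i)) * \det (bialternant r x x' (ext m)))
  = (-1) ^+ r * \det (\matrix_(i < r.+1, j < r.+1)
      (if unlift ord0 j is Some k then
         x k ^+ (l i + (r.+1 - i)) / (x k - z) - x' k ^+ (l i + (r.+1 - i)) / (x' k - z)
       else z ^+ (l i + (r.+1 - i)))).
Proof.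
move=> hx hx' hl lN.
have hlN i : (l i <= N)%N.
  by elim: i => // i; apply: leq_trans.
pose K j e := x j ^+ e / (x j - z) - x' j ^+ e / (x' j - z).
pose col (j : 'I_r.+1) e := if unlift ord0 j is Some k then K k e else z ^+ e.
(* The row after the last one is zero, so that the last row is not changed. *)
pose g i j := if (i < r.+1)%N then col j (l i + (r.+1 - i))%N else 0.
transitivity ((-1) ^+ r * \det (\matrix_(i < r.+1, j < r.+1) g i j)); last first.
  by congr (_ * \det _); apply/matrixP => i j; rewrite !mxE /g ltn_ord.
rewrite -(@det_sub_next_row _ _ g (fun i => z ^+ ((l i).+1 - l i.+1))); last first.
  by move=> j; rewrite /g ltnn.
rewrite (expand_det_col _ ord0) [X in _ = _ * X]big_ord_recr /=.
rewrite [X in _ = _ * (X + _)]big1 ?add0r; last first.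
  move=> i _; rewrite mxE; set cof := cofactor _ _ _.
  rewrite /g /= /col unlift_none !ltnS ltn_ord (ltnW (ltn_ord i)).
  rewrite -exprD (_ : _ + (_ + _) = l i + (r.+1 - i))%N ?subrr ?mul0r //.
  have := hl i; have := ltn_ord i; lia.
rewrite !mxE /g /= ltnSn ltnn /col unlift_none mulr0 subr0 subSn // subnn.
rewrite /cofactor addn0 mulrCA (mulrA (_ ^+ r)) -exprMn mulrNN mul1r expr1n mul1r.
rewrite addn1 exprS -!mulrA; congr (_ * _).
under eq_bigr do rewrite big_ord_recr /= (ext_out _ (leqnn r)) subn0.
transitivity (z ^+ l r * 
   \sum_(m : {ffun 'I_r -> 'I_N.+1} | [forall i : 'I_r, (l i.+1 <= m i <= l i)%N])
     (\prod_(i < r) z ^+ (l i - m i)) * \det (\matrix_(i < r, j < r)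
       (x j ^+ (m i + (r - i)) - x' j ^+ (m i + (r - i))))).
  rewrite mulr_sumr; apply: eq_big => [m|m _].
    by apply: eq_forallb => i; rewrite ext_ord.
  rewrite [RHS]mulrA [z ^+ l r * _]mulrC; congr (_ * _).
    by congr (_ * _); apply: eq_bigr => i _; rewrite ext_ord.
  by congr (\det _); apply/matrixP => i j; rewrite !mxE ext_ord.
rewrite (sum_box_det (fun i (k : 'I_N.+1) => l i.+1 <= k <= l i)%N
  (fun i k => z ^+ (l i - k))
  (fun i j k => x j ^+ (k + (r - i)) - x' j ^+ (k + (r - i)))).
congr (_ * \det _); apply/matrixP => i j; rewrite !mxE.
rewrite (sum_geometric (f := fun e => x j ^+ e - x' j ^+ e) (H := K j)) //; last first.
- move=> e; rewrite /K !exprS.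
  have := hx _ (ltn_ord j); have := hx' _ (ltn_ord j).
  rewrite -!(subr_eq0 _ z) => h1 h2; field.
  by rewrite h1 h2.
- exact: leqW.
rewrite !lift_max ltnS (ltnW (ltn_ord i)) ltnS ltn_ord liftK subSS.
by rewrite addSnnS -subSn // ltnW.
Qed.

(** As [m] is summed between [l] and its shift, each row becomes the difference
    of two consecutive rows of the matrix of the [H]; here the row after the last
    one is zero. *)
Lemma sum_upper_strip (R : comNzRingType) n N (y : R) (f H : 'I_n -> nat -> R)
    (l : nat -> nat) :
    (forall j e, H j e.+1 - y * H j e = f j e.+1) -> (forall j, H j 0%N = 0) ->
    (forall i, (l i.+1 <= l i)%N) -> (l 0 <= N)%N -> l n = 0%N ->
  \sum_(m : {ffun 'I_n -> 'I_N.+1} | horizontal_strip n l (ext m))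
    (\prod_(i < n) y ^+ (l i - ext m i)) *
       \det (\matrix_(i < n, j < n) f j (ext m i + (n - i))%N)
  = \det (\matrix_(i < n, j < n) H j (l i + (n - i))%N).
Proof.
move=> Hf H0 hl lN ln.
have hlN i : (l i <= N)%N.
  by elim: i => // i; apply: leq_trans.
rewrite -(@det_sub_next_row _ _ (fun i j => H j (l i + (n - i))%N)
  (fun i => y ^+ ((l i).+1 - l i.+1))); last first.
  by move=> j; rewrite ln subnn H0.
transitivity (\sum_(m : {ffun 'I_n -> 'I_N.+1} | [forall i : 'I_n, (l i.+1 <= m i <= l i)%N])
     (\prod_(i < n) y ^+ (l i - m i)) * \det (\matrix_(i < n, j < n)
       f j (m i + (n - i))%N)).
  apply: eq_big => [m|m _]; first by apply: eq_forallb => i; rewrite ext_ord.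
  congr (_ * _); first by apply: eq_bigr => i _; rewrite ext_ord.
  by congr (\det _); apply/matrixP => i j; rewrite !mxE ext_ord.
rewrite (sum_box_det (fun i (k : 'I_N.+1) => l i.+1 <= k <= l i)%N
  (fun i k => y ^+ (l i - k)) (fun i j k => f j (k + (n - i))%N)).
congr (\det _); apply/matrixP => i j; rewrite !mxE.
under eq_bigr => k _ do rewrite -(subnSK (ltn_ord i)) addnS.
rewrite (sum_geometric (f := fun e => f j e.+1) (H := H j)) //; last exact: leqW.
by rewrite addSnnS subnSK.
Qed.

(** The branching rule of symplectic characters.  After [sum_lower_strip], the
    recurrence required by [sum_upper_strip] is solved by multiples of
    [x_j^e - x'_j^e], since [x_j x'_j = x_0 x'_0] gives
    [x_j / (x_j - x'_0) = (x_0 - x_j) / (x_0 + x'_0 - x_j - x'_j)] and the same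
    with [x_j] and [x'_j] exchanged. *)
Lemma bialternant_branching (F : fieldType) r N (x x' : nat -> F) (l : nat -> nat) :
    (forall j, (j < r)%N -> x j.+1 * x' j.+1 = x 0%N * x' 0%N) ->
    x 0%N != x' 0%N -> x' 0%N != 0 ->
    (forall j, (j < r)%N -> x j.+1 != x' 0%N) ->
    (forall j, (j < r)%N -> x' j.+1 != x' 0%N) ->
    (forall j, (j < r)%N -> x 0%N + x' 0%N != x j.+1 + x' j.+1) ->
    (forall i, (l i.+1 <= l i)%N) -> (l 0 <= N)%N -> l r.+1 = 0%N ->
  (x 0%N - x' 0%N) * \prod_(j < r) (x 0%N + x' 0%N - (x j.+1 + x' j.+1)) *
  (\sum_(nu : {ffun 'I_r.+1 -> 'I_N.+1} | horizontal_strip r.+1 l (ext nu))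
    (\prod_(i < r.+1) x 0%N ^+ (l i - ext nu i)) *
    (\sum_(m : {ffun 'I_r -> 'I_N.+1} | horizontal_strip r (ext nu) (ext m))
      (\prod_(i < r.+1) x' 0%N ^+ (ext nu i - ext m i)) *
      \det (bialternant r (fun j => x j.+1) (fun j => x' j.+1) (ext m))))
  = \det (bialternant r.+1 x x' l).
Proof.
move=> hxx x0 x0' hx hx' hc hl lN lr.
apply: (mulfI x0'); rewrite mulrCA mulr_sumr.
pose K (j : 'I_r.+1) e := if unlift ord0 j is Some k then
         x k.+1 ^+ e / (x k.+1 - x' 0%N) - x' k.+1 ^+ e / (x' k.+1 - x' 0%N)
       else x' 0%N ^+ e.
pose d (j : 'I_r.+1) := if unlift ord0 j is Some k then
         - (x 0%N + x' 0%N - (x k.+1 + x' k.+1))^-1 else x' 0%N / (x 0%N - x' 0%N).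
pose H (j : 'I_r.+1) e := (x j ^+ e - x' j ^+ e) * d j.
rewrite (eq_bigr (fun nu : {ffun 'I_r.+1 -> 'I_N.+1} => (-1) ^+ r *
  ((\prod_(i < r.+1) x 0%N ^+ (l i - ext nu i)) * 
   \det (\matrix_(i < r.+1, j < r.+1) K j (ext nu i + (r.+1 - i))%N)))); last first.
  move=> nu /forallP hnu; rewrite mulrCA sum_lower_strip //.
  - by rewrite mulrCA.
  - move=> i; case: (ltnP i.+1 r.+1) => hi; last by rewrite ext_out.
    have /andP[_ h1] := hnu (Ordinal hi).
    by have /andP[h2 _] := hnu (Ordinal (ltnW hi)); apply: leq_trans h2.
  - by have /andP[_ h] := hnu ord0; apply: leq_trans lN.
rewrite -mulr_sumr (sum_upper_strip (H := H)) //; last first.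
- by move=> j; rewrite /H !expr0 subrr mul0r.
- move=> j e; rewrite /H /d /K; case: (unliftP ord0 j) => [k ->|->] /=.
    have {}hc := hc k (ltn_ord k); have {}hxx := hxx k (ltn_ord k).
    rewrite [bump 0 k](_ : _ = k.+1) //.
    have nc : x 0%N + x' 0%N - (x k.+1 + x' k.+1) != 0 by rewrite subr_eq0.
    have frac t t' : t + t' = x k.+1 + x' k.+1 -> t * t' = x 0%N * x' 0%N ->
        t != x' 0%N ->
        t / (t - x' 0%N) = (x 0%N - t) / (x 0%N + x' 0%N - (x k.+1 + x' k.+1)).
      move=> st pt nt; apply/eqP; rewrite eqr_div ?subr_eq0 // -subr_eq0 -st.
      have -> : t * (x 0%N + x' 0%N - (t + t')) - (x 0%N - t) * (t - x' 0%N)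
        = x 0%N * x' 0%N - t * t' by ring.
      by rewrite pt subrr.
    rewrite !exprSr -!mulrA.
    rewrite (frac _ (x' k.+1)) ?hx // (frac (x' k.+1) (x k.+1)) ?hx' //.
    - by field.
    - exact: addrC.
    - by rewrite mulrC.
  have n0 : x 0%N - x' 0%N != 0 by rewrite subr_eq0.
  by rewrite !exprS; field.
have -> : \matrix_(i < r.+1, j < r.+1) H j (l i + (r.+1 - i))%N =
    bialternant r.+1 x x' l *m diag_mx (\row_j d j).
  by apply/matrixP => i j; rewrite mul_mx_diag !mxE.
rewrite det_mulmx det_diag big_ord_recl !mxE {1}/d unlift_none.
rewrite [X in _ / _ * X](_ : _ = \prod_(j < r) - (x 0%N + x' 0%N - (x j.+1 + x' j.+1))^-1);
  last by apply: eq_bigr => j _; rewrite !mxE /d liftK.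
rewrite prodrN card_ord prodfV.
have n0 : x 0%N - x' 0%N != 0 by rewrite subr_eq0.
have n1 : \prod_(j < r) (x 0%N + x' 0%N - (x j.+1 + x' j.+1)) != 0.
  by apply/prodf_neq0 => j _; rewrite subr_eq0 hc.
set p := \prod_(j < r) _ in n1 *; set D := \det _.
have := signrMK r (1 : F); rewrite mulr1; set e := (-1) ^+ r => he.
transitivity (e * e * (x' 0%N * D)); first by field; rewrite n0 n1.
by rewrite he mul1r.
Qed.

(** * Vertical strips and determinants of shift operators *)

Definition decreasing r (l : nat -> nat) : bool := [forall i : 'I_r, l i.+1 <= l i]%N.

Definition vertical_strip r (m l : nat -> nat) : bool :=
  [forall i : 'I_r, m i <= l i <= (m i).+1]%N.

Section VerticalStrips.
Variables (R : comNzRingType) (N : nat) (w : R).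

(** The sum over all chains of vertical strips from [l] down to the empty
    partition in which the k-th partition has at most k parts, every row in which
    a step removes nothing having weight [w]: the shapes met when the entries of a
    row-strict plane partition are removed in increasing order. *)
Fixpoint vstrip_sum r (l : nat -> nat) : R :=
  if r is r'.+1 then
    \sum_(m : {ffun 'I_r' -> 'I_N.+1} | decreasing r' (ext m) && vertical_strip r (ext m) l)
      (\prod_(i < r) (if l i == ext m i then w else 1)) * vstrip_sum r' (ext m)
  else 1.

Lemma vstrip_sum_support r (l : nat -> nat) (i : 'I_r) : (r < l i)%N -> vstrip_sum r l = 0.
Proof.
elim: r l i => [|r IH] l i h; first by case: i h.
rewrite /= big1 // => m /andP[_ /forallP hv].
have /andP[h1 h2] := hv i.
have hr : (r < ext m i)%N by rewrite -ltnS; apply: leq_trans h2.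
have [ir|ri] := ltnP i r; last by rewrite ext_out in hr.
by rewrite (IH _ (Ordinal ir)) ?mulr0.
Qed.

(** The effect on [phi] of adding a vertical strip and one row: the argument grows
    by 1 for the row, and by 1 more, without the factor [w], for a cell. *)
Definition shift_op (phi : nat -> R) (e : nat) : R := w * phi e.+1 + phi e.+2.

(** If adding cells to [m] destroys the order of two consecutive rows, the two
    rows of the determinant become equal; so the sum may be taken over all ways
    of adding at most one cell to each row, which are independent. *)
Lemma sum_vertical_strip r (phi : 'I_r -> nat -> R) (m : nat -> nat) :
    (forall i, m i.+1 <= m i)%N -> (forall i, m i < N)%N ->
  \sum_(l : {ffun 'I_r -> 'I_N.+1} | decreasing r (ext l) && vertical_strip r m (ext l))
    (\prod_(i < r) (if ext l i == m i then w else 1)) *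
      \det (\matrix_(i < r, j < r) phi j (ext l i + (r - i))%N)
  = \det (\matrix_(i < r, j < r) shift_op (phi j) (m i + (r - i.+1))%N).
Proof.
move=> hm hN.
transitivity (\sum_(l : {ffun 'I_r -> 'I_N.+1} | [forall i : 'I_r, m i <= l i <= (m i).+1]%N)
    (\prod_(i < r) (if l i == m i :> nat then w else 1)) *
      \det (\matrix_(i < r, j < r) phi j (l i + (r - i))%N)).
  rewrite [LHS]big_mkcondl /=; apply: eq_big => [l|l hl].
    by apply: eq_forallb => i; rewrite ext_ord.
  case: ifPn => [_|].
    congr (_ * _); first by apply: eq_bigr => i _; rewrite ext_ord.
    by congr (\det _); apply/matrixP => i j; rewrite !mxE ext_ord.
  rewrite negb_forall => /existsP[i]; rewrite -ltnNge => hi.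
  have li : (i.+1 < r)%N.
    by rewrite ltnNge; apply/negP => h; rewrite (ext_out _ h) in hi.
  rewrite (determinant_alternate (i1 := i) (i2 := Ordinal li)) ?mulr0 //.
    by rewrite -val_eqE /= neq_ltn ltnSn.
  move=> j; rewrite !mxE; congr (phi j _).
  have /forallP hv := hl; move: (hv i) (hv (Ordinal li)) (hm i).
  rewrite -!ext_ord /=; move: hi li => /=; lia.
rewrite (sum_box_det (fun i (k : 'I_N.+1) => m i <= k <= (m i).+1)%N
  (fun i k => if k == m i :> nat then w else 1) (fun i j k => phi j (k + (r - i))%N)).
congr (\det _); apply/matrixP => i j; rewrite !mxE.
under eq_bigl do rewrite -[(_ <= (m i).+1)%N]ltnS.
rewrite (big_ord_interval (fun k => (if k == m i then w else 1) * phi j (k + (r - i))%N)) ?ltnS //.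
rewrite big_ltn ?ltnS ?leqnSn // big_nat1 eqxx gtn_eqF // mul1r /shift_op.
by rewrite -(subnSK (ltn_ord i)) !addSn !addnS.
Qed.

(** Removing the outermost strip turns [phi] into [shift_op phi] and leaves [r]
    free parts; the last row, whose part is zero, is then constant and
    the determinant can be expanded along it. *)
Lemma sum_vstrip_sum_det r (phi : 'I_r -> nat -> R) : (r <= N)%N ->
  \sum_(l : {ffun 'I_r -> 'I_N.+1} | decreasing r (ext l))
     vstrip_sum r (ext l) * \det (\matrix_(i < r, j < r) phi j (ext l i + (r - i))%N)
  = \det (\matrix_(i < r, j < r) iter (r - i) shift_op (phi j) 0%N).
Proof.
elim: r phi => [|r IH] phi rN.
  rewrite (eq_bigl predT) => [|l]; last by apply/forallP => -[].
  rewrite (big_pred1 [ffun=> ord0]) => [|l]; first by rewrite /= !det_mx00 mulr1.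
  by apply/esym/eqP/ffunP => -[].
rewrite /=; under eq_bigr do rewrite big_distrl /=.
rewrite (exchange_big_dep (fun m : {ffun 'I_r -> 'I_N.+1} => decreasing r (ext m))) /=; last first.
  by move=> l m _ /andP[].
transitivity (\sum_(m : {ffun 'I_r -> 'I_N.+1} | decreasing r (ext m)) vstrip_sum r (ext m) *
   \det (\matrix_(i < r.+1, j < r.+1) shift_op (phi j) (ext m i + (r - i))%N)).
  apply: eq_bigr => m dm; rewrite dm /=.
  have [big|] := boolP [exists i : 'I_r, r < ext m i]%N.
    have /existsP[i hi] := big; rewrite (vstrip_sum_support hi) mul0r big1 // => l _.
    by rewrite mulr0 mul0r.
  rewrite negb_exists => /forallP small.
  rewrite -(sum_vertical_strip phi (m := ext m)); first last.
  - move=> i; have [ir|ri] := ltnP i r.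
      have := small (Ordinal ir); rewrite -leqNgt /= => h.
      exact: leq_ltn_trans rN.
    by rewrite ext_out // (leq_ltn_trans _ rN).
  - move=> i; have [ir|ri] := ltnP i r; last by rewrite ext_out // ltnW.
    by have /forallP h := dm; apply: (h (Ordinal ir)).
  by rewrite mulr_sumr; apply: eq_bigr => l _; rewrite -mulrA mulrCA.
rewrite [RHS](expand_det_row _ ord_max).
under eq_bigr do rewrite (expand_det_row _ ord_max) mulr_sumr.
rewrite exchange_big; apply: eq_bigr => j _ /=.
rewrite [X in _ = X * _]mxE subSnn /= /cofactor.
rewrite (_ : \det (row' _ (col' _ _)) = \det (\matrix_(i < r, k < r)
    iter (r - i) shift_op (shift_op (phi (lift j k))) 0%N)); last first.
  congr (\det _); apply/matrixP => i k.
  by rewrite !mxE lift_max subSn ?iterSr // ltnW.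
rewrite -(IH _ (ltnW rN)) !mulr_sumr; apply: eq_bigr => m _.
rewrite mxE ext_out // subnn addn0.
rewrite (_ : \det (row' _ (col' _ _)) = \det (\matrix_(i < r, k < r)
    shift_op (phi (lift j k)) (ext m i + (r - i))%N)); first by ring.
by congr (\det _); apply/matrixP => i k; rewrite !mxE lift_max.
Qed.
End VerticalStrips.

(** * Plane partitions as matrices: removing the smallest entries *)

Lemma count_down_closed N (q : pred 'I_N) (j : 'I_N) :
  (forall j j' : 'I_N, j < j' -> q j' -> q j)%N -> (j < #|q|)%N = q j.
Proof.
move=> hq; have card_lt (k : nat) : (k <= N)%N -> #|[pred i : 'I_N | i < k]%N| = k.
  move=> kN; rewrite -sum1_card -[RHS]subn0 -[RHS]muln1.
  rewrite -sum_nat_const_nat (big_nat_widen _ _ _ _ _ kN) big_mkord.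
  by apply: eq_bigl => i.
apply/idP/idP => [|qj].
  apply: contraLR => nq; rewrite -leqNgt -[X in (_ <= X)%N](card_lt j (ltnW (ltn_ord j))).
  apply/subset_leq_card/subsetP => i; rewrite !inE => qi.
  by rewrite ltnNge; apply: contra nq; rewrite leq_eqVlt => /orP[/eqP/val_inj->|/hq]; auto.
rewrite -[X in (X <= _)%N](card_lt j.+1 (ltn_ord j)).
apply/subset_leq_card/subsetP => i; rewrite !inE ltnS leq_eqVlt.
by case/orP => [/eqP/val_inj->//|/hq]; apply.
Qed.

Lemma eq_from_lt_ord N (a b : nat) : (a <= N)%N -> (b <= N)%N ->
  (forall j : 'I_N, (j < a)%N = (j < b)%N) -> a = b.
Proof.
move=> aN bN h; case: (ltngtP a b) => // ab.
  by have := h (Ordinal (leq_trans ab bN)); rewrite /= ab ltnn.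
by have := h (Ordinal (leq_trans ab aN)); rewrite /= ab ltnn.
Qed.

Section Fillings.
Variables (rs cs : bool) (n N M : nat).
Implicit Types (b l m : nat -> nat) (p : {ffun 'I_n * 'I_N -> 'I_M.+1}).

(** A filling is a matrix that is zero outside the shape [l], with entries of row
    [i] at most [b i]; [rs] and [cs] say whether rows and columns decrease
    strictly.  The number of rows and columns is kept fixed while the shape
    shrinks, which avoids a type depending on the shape. *)
Definition filling b l p : bool :=
  [&& [forall i : 'I_n, forall j : 'I_N,
         ((0 < p (i, j)) == (j < l i)) && (p (i, j) <= b i)],
      [forall i : 'I_n, forall j : 'I_N, forall k : 'I_N,
         (j < k) && (0 < p (i, k)) ==> (p (i, k) + rs <= p (i, j))]
    & [forall i : 'I_n, forall k : 'I_n, forall j : 'I_N,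
         (i < k) && (0 < p (k, j)) ==> (p (k, j) + cs <= p (i, j))]]%N.

Lemma fillingP b l p :
  reflect [/\ forall i j, (0 < p (i, j))%N = (j < l i)%N,
              forall i j, (p (i, j) <= b i)%N,
              forall i (j k : 'I_N), (j < k)%N -> (0 < p (i, k))%N ->
                (p (i, k) + rs <= p (i, j))%N
            & forall (i k : 'I_n) j, (i < k)%N -> (0 < p (k, j))%N ->
                (p (k, j) + cs <= p (i, j))%N]
          (filling b l p).
Proof.
apply: (iffP and3P) => [[/forallP h1 /forallP h2 /forallP h3]|[h0 h1 h2 h3]].
  split=> [i j|i j|i j k jk pk|i k j ik pk].
  - by have /forallP/(_ j)/andP[/eqP] := h1 i.
  - by have /forallP/(_ j)/andP[] := h1 i.
  - by have /forallP/(_ j)/forallP/(_ k) := h2 i; rewrite jk pk.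
  - by have /forallP/(_ k)/forallP/(_ j) := h3 i; rewrite ik pk.
split; apply/forallP => i; apply/forallP => j.
- by rewrite h0 h1 eqxx.
- by apply/forallP => k; apply/implyP => /andP[]; apply: h2.
- by apply/forallP => k; apply/implyP => /andP[]; apply: h3.
Qed.

(** What is known about the shape [m] left after the entries 1 have been removed
    from a filling of shape [l]: strict rows lose at most one cell each, strict
    columns likewise, and rows bounded by 0 are empty. *)
Definition strip b l m : bool :=
  [forall i : 'I_n, [&& m i <= l i, m i.+1 <= m i, rs ==> (l i <= (m i).+1),
    cs ==> (l i.+1 <= m i) & (b i == 0) ==> (l i == 0)]]%N.

Variable (R : comNzRingType).
Implicit Types y : nat -> R.

(** Zeros are empty cells; [y v] is the weight of the entry [v + 1], so that
    subtracting 1 from all entries shifts [y]. *)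
Definition entry_weight y (v : nat) : R := if v is v'.+1 then y v' else 1.

Definition fill_sum b y l : R :=
  \sum_(p | filling b l p) \prod_ij entry_weight y (p ij).

Definition inner_shape p : {ffun 'I_n -> 'I_N.+1} :=
  [ffun i => inord #|[pred j | 1 < p (i, j)]|%N].

Lemma inner_shapeE b l p (i : 'I_n) (j : 'I_N) : filling b l p ->
  (j < ext (inner_shape p) i)%N = (1 < p (i, j))%N.
Proof.
case/fillingP => _ _ hrow _; rewrite ext_ord ffunE inordK; last first.
  by rewrite ltnS -[X in (_ <= X)%N]card_ord max_card.
apply: (@count_down_closed _ [pred j | 1 < p (i, j)]%N) => {}j k jk /= pk.
exact: leq_trans pk (leq_trans (leq_addr _ _) (hrow _ _ _ jk (ltnW pk))).
Qed.

Lemma inner_shape_strip b l p : (l 0 <= N)%N -> l n = 0%N ->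
  (forall i, l i.+1 <= l i)%N -> filling b l p -> strip b l (ext (inner_shape p)).
Proof.
move=> lN ln hl fp; have m1 := inner_shapeE _ _ fp.
case/fillingP: fp => p0 pb hrow hcol; set m := ext _ in m1 *.
have hlN i : (l i <= N)%N by elim: i => // i; apply: leq_trans.
have mN i : (m i <= N)%N by apply: ext_bound.
apply/forallP => i; apply/and5P; split.
- rewrite leqNgt; apply/negP => h.
  have := m1 i (Ordinal (leq_trans h (mN i))); rewrite h => /esym/ltnW.
  by rewrite p0 /= ltnn.
- rewrite leqNgt; apply/negP => h.
  have [ri|ri] := ltnP i.+1 n; last by rewrite /m (ext_out _ ri) in h.
  have := m1 (Ordinal ri) (Ordinal (leq_trans h (mN _))); rewrite h => /esym pk.
  have := hcol i (Ordinal ri) _ (ltnSn i) (ltnW pk).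
  move/(leq_trans (leq_addr _ _))/(leq_trans pk).
  by rewrite -m1 /= ltnn.
- apply/implyP => rs1; rewrite leqNgt; apply/negP => h.
  have jN := leq_trans h (hlN _).
  have := p0 i (Ordinal jN); rewrite h => pk.
  have := hrow i (Ordinal (ltnW jN)) (Ordinal jN) (ltnSn _) pk.
  by rewrite rs1 addn1 => /(leq_ltn_trans pk); rewrite -m1 /= ltnn.
- apply/implyP => cs1; rewrite leqNgt; apply/negP => h.
  have [ri|ri] := ltnP i.+1 n; last first.
    by rewrite (_ : i.+1 = n) ?ln // in h; apply/eqP; rewrite eqn_leq ri ltn_ord.
  have jN := leq_trans h (hlN _).
  have := p0 (Ordinal ri) (Ordinal jN); rewrite h => pk.
  have := hcol i (Ordinal ri) _ (ltnSn i) pk.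
  by rewrite cs1 addn1 => /(leq_ltn_trans pk); rewrite -m1 /= ltnn.
- apply/implyP => /eqP bi; rewrite -leqn0 leqNgt; apply/negP => h.
  have := p0 i (Ordinal (leq_trans h (hlN _))); rewrite h => pk.
  by have := leq_trans pk (pb _ _); rewrite bi.
Qed.

(** The entries above 1, lowered by 1, form a filling of the inner shape; it
    determines the filling, because [p = p' + 1] on the cells of [l]. *)
Lemma fill_sum_peel b y l :
    (l 0 <= N)%N -> l n = 0%N -> (forall i, l i.+1 <= l i)%N ->
    (forall i, b i <= M)%N ->
  fill_sum b y l =
  \sum_(m : {ffun 'I_n -> 'I_N.+1} | strip b l (ext m))
     (\prod_(i < n) y 0%N ^+ (l i - ext m i)) *
       fill_sum (fun i => (b i).-1) (fun v => y v.+1) (ext m).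
Proof.
move=> lN ln hl bM.
have hanti i k : (i <= k -> l k <= l i)%N.
  by move=> ik; rewrite -(subnK ik); elim: (k - i)%N => // d; apply: leq_trans (hl _).
rewrite /fill_sum (partition_big inner_shape
  (fun m : {ffun 'I_n -> 'I_N.+1} => strip b l (ext m))); last first.
  by move=> p; apply: inner_shape_strip.
apply: eq_bigr => m /forallP sm; rewrite mulr_sumr.
have {sm} sm (i : 'I_n) := and5P (sm i).
pose up p : {ffun 'I_n * 'I_N -> 'I_M.+1} :=
  [ffun ij => inord (p ij + (ij.2 < l ij.1))%N].
pose down p : {ffun 'I_n * 'I_N -> 'I_M.+1} := [ffun ij => inord (p ij).-1].
have downE p ij : down p ij = (p ij).-1 :> nat.
  by rewrite ffunE inordK // (leq_ltn_trans (leq_pred _)).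
rewrite (reindex_onto up down) /=; last first.
  move=> p /andP[/fillingP[p0 _ _ _] _]; apply/ffunP => -[i j]; apply/val_inj.
  rewrite ffunE downE /= -p0; case: posnP => [->|pp]; first by rewrite inordK.
  by rewrite addn1 prednK // inordK.
have upE p : filling (fun i => (b i).-1) (ext m) p ->
    forall i j, up p (i, j) = (p (i, j) + (j < l i))%N :> nat.
  case/fillingP => p0 pb _ _ i j; rewrite ffunE inordK //= ltnS.
  have [_ _ _ _ /implyP hb] := sm i; have := pb i j.
  case: (posnP (b i)) hb => [-> /(_ isT)/eqP ->|bi _ pi] /=.
    by rewrite leqn0 => /eqP->.
  apply: leq_trans (bM i); rewrite -(prednK bi) -[(b i).-1.+1]addn1.
  by apply: leq_add => //; apply: leq_b1.
have predE p : [&& filling b l (up p), inner_shape (up p) == m & down (up p) == p]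
    = filling (fun i => (b i).-1) (ext m) p.
  apply/idP/idP.
    case/and3P => fu /eqP sh /eqP du.
    have m1 i j := inner_shapeE i j fu.
    have pE ij : p ij = (up p ij).-1 :> nat by rewrite -downE du.
    rewrite sh in m1; case/fillingP: fu => p0 pb hrow hcol.
    apply/fillingP; split=> [i j|i j|i j k jk|i k j ik]; rewrite !pE.
    - by rewrite m1; case: (val (up p _)) => [|[]].
    - by have := pb i j; case: (b i) => [|b']; case: (val (up p _)).
    - move=> h; have := hrow i j k jk; move: h; case: (val (up p (i, k))) => //= v hv.
      by move=> /(_ isT); case: (val (up p (i, j))).
    - move=> h; have := hcol i k j ik; move: h; case: (val (up p (k, j))) => //= v hv.
      by move=> /(_ isT); case: (val (up p (i, j))).
  move=> fp; have uE := upE _ fp; case/fillingP: fp => p0 pb hrow hcol.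
  have ml (i : 'I_n) : (ext m i <= l i)%N by have [] := sm i.
  have fu : filling b l (up p).
    apply/fillingP; split=> [i j|i j|i j k jk|i k j ik]; rewrite !uE.
    - by rewrite addn_gt0 p0 lt0b; case: (ltnP j (ext m i)) => //= jm; rewrite (leq_trans jm (ml i)).
    - have [_ _ _ _ /implyP hb] := sm i; have := pb i j.
      case: (posnP (b i)) hb => [-> /(_ isT)/eqP ->|bi _ pi] /=.
        by rewrite leqn0 => /eqP->.
      rewrite -[X in (_ <= X)%N](prednK bi) -[(b i).-1.+1]addn1.
      by apply: leq_add => //; apply: leq_b1.
    - have [_ _ /implyP hr _ _] := sm i; case: (posnP (p (i, k))) => [->|pk].
        rewrite add0n lt0b => kl; rewrite kl (ltn_trans jk kl) addnC leq_add2r.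
        case: rs hr => // /(_ isT) hr; rewrite p0 -ltnS.
        exact: leq_trans (leq_ltn_trans jk kl) hr.
      move=> _; have kl : (k < l i)%N by rewrite p0 in pk; apply: leq_trans pk (ml i).
      by rewrite kl (ltn_trans jk kl) addnAC leq_add2r; apply: hrow.
    - have [_ _ _ /implyP hc _] := sm i; case: (posnP (p (k, j))) => [->|pk].
        rewrite add0n lt0b => jl; have jl' := leq_trans jl (hanti _ _ (ltnW ik)).
        rewrite jl jl' addnC leq_add2r; case: cs hc => // /(_ isT) hc; rewrite p0.
        exact: leq_trans jl (leq_trans (hanti _ _ ik) hc).
      move=> _; have jl : (j < l k)%N by rewrite p0 in pk; apply: leq_trans pk (ml k).
      rewrite jl (leq_trans jl (hanti _ _ (ltnW ik))) addnAC leq_add2r.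
      exact: hcol.
  rewrite fu /=; apply/andP; split; last first.
    apply/eqP/ffunP => -[i j]; apply/val_inj; rewrite /= downE uE.
    rewrite addnC; have := p0 i j.
    case: (ltnP j (l i)) => [_ _|]; first by [].
    by move=> /(leq_trans (ml i)); rewrite leqNgt => /negbTE->; case: (val (p _)).
  apply/eqP/ffunP => i; apply/val_inj; rewrite /= -!ext_ord.
  apply: (@eq_from_lt_ord N) => [||j]; try exact: ext_bound.
  rewrite (inner_shapeE _ _ fu) uE -p0; have := p0 i j.
  case: (nat_of_ord (p _)) => [|v] /=.
    by case: (j < l i)%N.
  by move=> /esym jm; rewrite (leq_trans jm (ml i)) addn1.
apply: eq_big => [p|p]; first by rewrite -andbA predE.
rewrite -andbA predE => fp.
have prodE (f : 'I_n * 'I_N -> R) : \prod_ij f ij = \prod_i \prod_j f (i, j).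
  by rewrite pair_bigA; apply: eq_bigr => -[].
rewrite !prodE -big_split.
apply: eq_bigr => i _ /=.
have {sm} [ml _ _ _ _] := sm i; have lNi : (l i <= N)%N by apply: leq_trans (hanti _ _ (leq0n i)) lN.
have -> : y 0%N ^+ (l i - ext m i) =
    \prod_(j < N) (if (ext m i <= j < l i)%N then y 0%N else 1).
  rewrite -big_mkcond (big_ord_interval (fun=> y 0%N) lNi).
  by rewrite prodr_const_nat.
rewrite -big_split; apply: eq_bigr => j _ /=; rewrite (upE _ fp).
case/fillingP: fp => /(_ i j) p0 _ _ _; rewrite [(ext m i <= j)%N]leqNgt -p0.
case: (val (p (i, j))) p0 => [|v] /= p0.
  by rewrite mulr1; case: (j < l i)%N.
rewrite mul1r (leq_trans _ ml) ?addn1 //.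
Qed.
End Fillings.

(** * Summing plane partitions of a fixed shape *)

(** Trailing zeros can be dropped, since padding restores them. *)
Lemma sum_ext_widen (V : nmodType) r n N (Q : pred (nat -> nat)) (G : (nat -> nat) -> V) :
    (r <= n)%N ->
    (forall m : {ffun 'I_n -> 'I_N.+1}, Q (ext m) -> forall i, (r <= i)%N -> ext m i = 0%N) ->
  \sum_(m : {ffun 'I_n -> 'I_N.+1} | Q (ext m)) G (ext m) =
  \sum_(m : {ffun 'I_r -> 'I_N.+1} | Q (ext m)) G (ext m).
Proof.
move=> rn hQ.
pose h n1 n2 (m : {ffun 'I_n1 -> 'I_N.+1}) : {ffun 'I_n2 -> 'I_N.+1} :=
  [ffun i : 'I_n2 => inord (ext m i)].
have extE n1 n2 (m : {ffun 'I_n1 -> 'I_N.+1}) :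
    (forall i, (n2 <= i)%N -> ext m i = 0%N) -> ext (h n1 n2 m) = ext m.
  move=> hm; apply: functional_extensionality => k.
  have [kn|nk] := ltnP k n2; last by rewrite (ext_out _ nk) hm.
  by rewrite -[k]/(val (Ordinal kn)) ext_ord ffunE inordK // ltnS ext_bound.
have hK n1 n2 (m : {ffun 'I_n1 -> 'I_N.+1}) :
    (forall i, (n2 <= i)%N -> ext m i = 0%N) -> h n2 n1 (h n1 n2 m) = m.
  move=> hm; apply/ffunP => i; apply/val_inj.
  by rewrite ffunE extE //= ext_ord inordK.
have out (m : {ffun 'I_r -> 'I_N.+1}) i : (n <= i)%N -> ext m i = 0%N.
  by move=> ni; rewrite ext_out // (leq_trans rn).
rewrite (reindex_onto (h r n) (h n r)) /=; last by move=> m Qm; apply/hK/hQ.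
apply: eq_big => m; last by move=> _; rewrite extE //; apply: out.
by rewrite extE; [rewrite hK ?eqxx ?andbT //; apply: out | apply: out].
Qed.

Lemma prod_ord_widen (R : pzSemiRingType) r n (f : nat -> R) : (r <= n)%N ->
  (forall i, (r <= i)%N -> f i = 1) -> \prod_(i < n) f i = \prod_(i < r) f i.
Proof.
move=> rn hf; rewrite (big_ord_widen _ f rn) [RHS]big_mkcond; apply: eq_bigr => i _.
by case: ltnP => // /hf.
Qed.

Lemma prod_lt_recl (R : comPzSemiRingType) r (f : nat -> nat -> R) :
  \prod_(i < r.+1) \prod_(j < r.+1 | (i < j)%N) f i j =
  \prod_(j < r) f 0%N j.+1 * \prod_(i < r) \prod_(j < r | (i < j)%N) f i.+1 j.+1.
Proof.
rewrite big_ord_recl; congr (_ * _).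
  by rewrite big_mkcond big_ord_recl /= mul1r.
apply: eq_bigr => i _; rewrite big_mkcond big_ord_recl /= mul1r [RHS]big_mkcond.
by apply: eq_bigr => j _.
Qed.

Section FillSumFacts.
Variables (rs cs : bool) (n N M : nat) (R : comNzRingType).

Lemma fill_sum_bound0 (b : nat -> nat) y (l : nat -> nat) (i : 'I_n) : b i = 0%N -> (0 < l i <= N)%N ->
  @fill_sum rs cs n N M R b y l = 0.
Proof.
move=> bi /andP[l0 lN]; rewrite /fill_sum big_pred0 // => p; apply/negP => /fillingP[p0 pb _ _].
have N0 := leq_trans l0 lN.
by have := p0 i (Ordinal N0); have := pb i (Ordinal N0); rewrite bi leqn0 l0 => /eqP->.
Qed.

Lemma fill_sum_empty b y (l : nat -> nat) : (forall i, l i = 0%N) ->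
  @fill_sum rs cs n N M R b y l = 1.
Proof.
move=> l0; rewrite /fill_sum (big_pred1 [ffun=> ord0]).
  by apply: big1 => ij _; rewrite ffunE.
move=> p; apply/fillingP/eqP => [[p0 _ _ _]|->].
  apply/ffunP => -[i j]; apply/val_inj; rewrite ffunE /=; apply/eqP.
  by rewrite -leqn0 leqNgt p0 l0.
by split=> [i j|i j|i j k|i k j]; rewrite !ffunE ?l0.
Qed.

End FillSumFacts.

Lemma antitone_seq (l : nat -> nat) : (forall i, l i.+1 <= l i)%N ->
  forall i k, (i <= k -> l k <= l i)%N.
Proof.
move=> hl i k ik; rewrite -(subnK ik); elim: (k - i)%N => // d.
exact: leq_trans (hl _).
Qed.

Lemma ext_decreasing r N (m : {ffun 'I_r -> 'I_N}) :
  (forall i, i < r -> ext m i.+1 <= ext m i)%N -> forall i, (ext m i.+1 <= ext m i)%N.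
Proof. by move=> h i; have [/h|ri] := ltnP i r; rewrite // ext_out // leqW. Qed.

(** The weights of the entries 1, 2, 3, 4, ...: odd entries carry the [x], even
    entries the [x']. *)
Definition alternate (T : Type) (x x' : nat -> T) (v : nat) : T :=
  if odd v then x' v./2 else x v./2.

(** Removing the entries 1 and then the entries 2 removes two horizontal strips;
    after that the bound of the last row is 0, so this row is empty and
    [bialternant_branching] applies. *)
Lemma symplectic_fill_sum (F : fieldType) n N M r (x x' : nat -> F) (l : nat -> nat) :
    (r <= n)%N -> (r.*2 <= M)%N ->
    (forall i j, (i < r)%N -> (j < r)%N -> x i * x' i = x j * x' j) ->
    (forall i, (i < r)%N -> x' i != 0) ->
    (forall i j, (i < r)%N -> (j < r)%N -> x i != x' j) ->
    (forall i j, (i < j)%N -> (j < r)%N -> x' j != x' i) ->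
    (forall i j, (i < j)%N -> (j < r)%N -> x i + x' i != x j + x' j) ->
    (forall i, l i.+1 <= l i)%N -> (l 0 <= N)%N -> l r = 0%N ->
  \prod_(i < r) (x i - x' i) *
  \prod_(i < r) \prod_(j < r | (i < j)%N) (x i + x' i - (x j + x' j)) *
  fill_sum false true n N M (fun i => (r - i).*2) (alternate x x') l
  = \det (bialternant r x x' l).
Proof.
elim: r x x' l => [|r IH] x x' l rn rM hs h0 hxx hx' hc hl lN lr.
  rewrite !big_ord0 det_mx00 !mul1r fill_sum_empty // => i.
  by apply/eqP; rewrite -leqn0 -lr antitone_seq.
have nn : l n = 0%N by apply/eqP; rewrite -leqn0 -lr antitone_seq.
have lout i : (r < i)%N -> l i = 0%N.
  by move=> ri; apply/eqP; rewrite -leqn0 -lr antitone_seq.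
rewrite -(@bialternant_branching F r N x x' l) //; first last.
- by move=> j jr; apply: hc.
- by move=> j jr; apply: hx'.
- by move=> j jr; apply: hxx.
- exact: h0.
- exact: hxx.
- by move=> j jr; apply: hs.
rewrite (prod_lt_recl _ (fun i j => x i + x' i - (x j + x' j))) big_ord_recl fill_sum_peel //; last first.
  by move=> i; apply: leq_trans rM; rewrite leq_double leq_subr.
rewrite (@sum_ext_widen _ r.+1 n N (strip _ _ _ _ l) (fun m => (\prod_(i < n) alternate x x' 0 ^+ (l i - m i)) *
   fill_sum false true n N M (fun i => ((r.+1 - i).*2).-1)
     (fun v => alternate x x' v.+1) m)) //; last first.
  move=> m /forallP sm i ri; have [ni|ni] := ltnP i n; last by rewrite ext_out.
  have [+ _ _ _ _] := and5P (sm (Ordinal ni)).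
  by rewrite /= (lout _ ri) leqn0 => /eqP.
set V := \prod_(i < r) (x (lift ord0 i) - _) ; set W := \prod_(i < r) \prod_(j < r | _) _.
rewrite (mulrACA _ V) -(mulrA _ (V * W)); congr (_ * _); rewrite mulr_sumr.
have out (s : nat) (m : {ffun 'I_s -> 'I_N.+1}) i : (s <= i)%N -> ext m i = 0%N.
  exact: ext_out.
apply: eq_big => [nu|nu /forallP snu].
  apply/forallP/forallP => [snu i|hnu i].
    have [h1 _ _ h2 _] := and5P (snu (Ordinal (leq_trans (ltn_ord i) rn))).
    by rewrite h1 andbT.
  have {hnu} hnu k : (l k.+1 <= ext nu k <= l k)%N.
    have [kr|rk] := ltnP k r.+1; first exact: (hnu (Ordinal kr)).
    by rewrite out // !lout // ltnW.
  have /andP[h1 h2] := hnu i; have /andP[_ h3] := hnu i.+1.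
  rewrite h1 h2 (leq_trans h3 h1) double_eq0 subn_eq0 /=.
  by apply/implyP => ri; rewrite lout.
have snu' k : [/\ (ext nu k <= l k)%N, (ext nu k.+1 <= ext nu k)%N & (l k.+1 <= ext nu k)%N].
  have [kr|rk] := ltnP k n; last first.
    by rewrite !out ?lout // (leq_trans rn) // ltnW.
  by have [h1 h3 _ h2 _] := and5P (snu (Ordinal kr)).
rewrite (@prod_ord_widen _ r.+1 n (fun i => alternate x x' 0 ^+ (l i - ext nu i))) //; last first.
  by move=> i ri; rewrite lout.
rewrite mulrCA; congr (_ * _).
rewrite fill_sum_peel; first last.
- move=> i; apply: leq_trans (leq_pred _) _.
  by apply: leq_trans rM; rewrite leq_double leq_subr.
- by move=> k; have [] := snu' k.
- exact: out.
- exact: ext_bound.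
(* The bound of row [r] is now 0, so shapes with a cell in that row have no fillings. *)
rewrite (bigID (fun m : {ffun 'I_n -> 'I_N.+1} => ext m r == 0%N)) /= addrC big1 ?add0r; last first.
  move=> m /andP[_ mr]; rewrite (@fill_sum_bound0 _ _ n N M F _ _ _ (Ordinal rn)) ?mulr0 //=.
    by rewrite subSnn.
  by rewrite lt0n mr ext_bound.
rewrite (@sum_ext_widen _ r n N (fun f => strip _ _ _ _ _ f && (f r == 0%N))
   (fun f => (\prod_(i < n) alternate x x' 1 ^+ (ext nu i - f i)) *
     fill_sum false true n N M (fun i => ((r.+1 - i).*2).-1.-1)
     (fun v => alternate x x' v.+2) f)) //; first last.
- move=> m /andP[/forallP sm /eqP mr] i; rewrite leq_eqVlt => /orP[/eqP<- //|ri].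
  have [ni|ni] := ltnP i n; last by rewrite ext_out.
  have [+ _ _ _ _] := and5P (sm (Ordinal ni)).
  by rewrite /= (out _ nu _ ri) leqn0 => /eqP.
- exact: ltnW.
rewrite mulr_sumr; apply: eq_big => [m|m /andP[/forallP sm _]].
  rewrite (out _ m r) // eqxx andbT.
  apply/forallP/forallP => [sm i|hm i].
    have [h1 _ _ h2 _] := and5P (sm (Ordinal (leq_trans (ltn_ord i) (ltnW rn)))).
    by rewrite h1 andbT.
  have {hm} hm k : (ext nu k.+1 <= ext m k <= ext nu k)%N.
    have [kr|rk] := ltnP k r; first exact: (hm (Ordinal kr)).
    by rewrite out // out.
  have /andP[h1 h2] := hm i; have /andP[_ h3] := hm i.+1.
  rewrite h1 h2 (leq_trans h3 h1) /=; apply/implyP.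
  by have [ir|ri] := ltnP i r.+1; [rewrite (subSn (ltnSE ir)) | rewrite (out _ nu)].
rewrite mulrCA (@prod_ord_widen _ r.+1 n (fun i => alternate x x' 1 ^+ (ext nu i - ext m i))) //; last first.
  by move=> i ri; rewrite (out _ nu).
congr (_ * _).
have -> : (fun i => ((r.+1 - i).*2).-1.-1) = (fun i => (r - i).*2).
  apply: functional_extensionality => i; have [ir|ri] := ltnP i r.+1.
    by rewrite (subSn (ltnSE ir)).
  by rewrite (eqP ri) (_ : (r - i = 0)%N) //; apply/eqP; rewrite subn_eq0 ltnW.
have -> : (fun v => alternate x x' v.+2) =
    alternate (fun j => x j.+1) (fun j => x' j.+1).
  by apply: functional_extensionality => v; rewrite /alternate /= negbK.
rewrite -IH //.
- exact: ltnW.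
- by apply: leq_trans rM; rewrite leq_double.
- by move=> i j ir jr; apply: hs.
- by move=> i ir; apply: h0.
- by move=> i j ir jr; apply: hxx.
- by move=> i j ij jr; apply: hx'.
- by move=> i j ij jr; apply: hc.
- apply: ext_decreasing => i ir.
  by have [_ + _ _ _] := and5P (sm (Ordinal (ltn_trans ir rn))).
- exact: ext_bound.
- exact: out.
Qed.

(** After the entries 1 have been removed, the bound of the last row is 0.  A row
    contributes [w] to the left-hand side for each step in which it loses no
    cell, which together with [w] to the number of its cells gives [w] to the
    number of steps. *)
Lemma vstrip_fill_sum (R : comNzRingType) (w : R) n N M r (l : nat -> nat) :
    (r <= n)%N -> (r <= M)%N ->
    (forall i, l i.+1 <= l i)%N -> (l 0 <= N)%N -> l r = 0%N ->
  vstrip_sum N w r l * w ^+ (\sum_(i < r) l i)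
  = w ^+ 'C(r.+1, 2) * fill_sum true false n N M (fun i => r - i)%N (fun=> 1) l.
Proof.
elim: r l => [|r IH] l rn rM hl lN lr.
  rewrite big_ord0 fill_sum_empty ?mulr1 // => i.
  by apply/eqP; rewrite -leqn0 -lr antitone_seq.
have nn : l n = 0%N by apply/eqP; rewrite -leqn0 -lr antitone_seq.
have lout i : (r < i)%N -> l i = 0%N.
  by move=> ri; apply/eqP; rewrite -leqn0 -lr antitone_seq.
rewrite fill_sum_peel //; last first.
  by move=> i; apply: leq_trans rM; rewrite leq_subr.
have out (s : nat) (m : {ffun 'I_s -> 'I_N.+1}) i : (s <= i)%N -> ext m i = 0%N.
  exact: ext_out.
rewrite [X in _ = _ * X](bigID (fun m : {ffun 'I_n -> 'I_N.+1} => ext m r == 0%N)) /=.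
rewrite [X in _ = _ * X]addrC [X in _ = _ * (X + _)]big1 ?add0r; last first.
  move=> m /andP[_ mr]; rewrite (@fill_sum_bound0 _ _ n N M R _ _ _ (Ordinal rn)) ?mulr0 //=.
    by rewrite subSnn.
  by rewrite lt0n mr ext_bound.
rewrite (@sum_ext_widen _ r n N (fun f => strip _ _ _ _ _ f && (f r == 0%N))
   (fun f => (\prod_(i < n) 1 ^+ (l i - f i)) *
     fill_sum true false n N M (fun i => (r.+1 - i).-1)%N (fun=> 1) f)) //; first last.
- move=> m /andP[/forallP sm /eqP mr] i; elim: i => [|i IHi]; first by rewrite leqn0 => /eqP r0; rewrite -[X in ext m X]r0.
  rewrite leq_eqVlt => /orP[/eqP<- //|/IHi {}IHi].
  have [ni|ni] := ltnP i n; last by rewrite ext_out // leqW.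
  have [_ + _ _ _] := and5P (sm (Ordinal ni)).
  by rewrite /= IHi leqn0 => /eqP.
- exact: ltnW.
rewrite mulr_suml mulr_sumr.
have -> : (fun i => (r.+1 - i).-1)%N = (fun i => (r - i))%N.
  by apply: functional_extensionality => i; rewrite -subnS subSS.
apply: eq_big => [m|m /andP[/forallP dm /forallP vm]].
  rewrite out // eqxx andbT; apply/andP/forallP => [[/forallP dm /forallP vm] i|sm].
    have {dm} dm k : (ext m k.+1 <= ext m k)%N.
      by have [kr|rk] := ltnP k r; [exact: (dm (Ordinal kr)) | rewrite out // leqW].
    rewrite dm subn_eq0 /=.
    have [ir|ri] := ltnP i r.+1; last by rewrite out ?lout // ltnW.
    by have /andP[-> ->] := vm (Ordinal ir).
  split; apply/forallP => i.
    by have [_ + _ _ _] := and5P (sm (Ordinal (leq_trans (ltn_ord i) (ltnW rn)))).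
  have [h1 _ h2 _ _] := and5P (sm (Ordinal (leq_trans (ltn_ord i) rn))).
  by rewrite h1.
rewrite [X in _ = _ * (X * _)]big1 => [|i _]; last by rewrite expr1n.
have key : (\prod_(i < r.+1) (if l i == ext m i then w else 1)) * w ^+ (\sum_(i < r.+1) l i)
    = w ^+ (\sum_(i < r) ext m i) * w ^+ r.+1.
  rewrite (_ : w ^+ r.+1 = \prod_(i < r.+1) w); last by rewrite prodr_const card_ord.
  have -> : (\sum_(i < r) ext m i = \sum_(i < r.+1) ext m i)%N.
    by rewrite big_ord_recr /= (out _ m r) // addn0.
  rewrite !(big_morph (GRing.exp w) (exprD w) (expr0 w)) -!big_split.
  apply: eq_bigr => i _ /=; have /andP[] := vm i.
  rewrite leq_eqVlt => /orP[/eqP->|lt1 lt2]; first by rewrite eqxx mulrC.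
  by rewrite gtn_eqF // mul1r (eqP (_ : l i == (ext m i).+1)) ?exprSr // eqn_leq lt2.
rewrite mul1r binS bin1 exprD [RHS]mulrAC -IH //.
- by rewrite mulrAC key mulrC mulrA.
- exact: ltnW.
- exact: ltnW.
- by apply: ext_decreasing => i ir; apply: (dm (Ordinal ir)).
- exact: ext_bound.
- exact: out.
Qed.

(** * From fillings of cells to matrices *)

Section CellMatrices.
Variables (n N M : nat) (lam : 'I_n -> nat).
Hypothesis lamN : forall i, (lam i <= N)%N.
Implicit Type P : {ffun cells lam -> 'I_M.+1}.

Definition cell (i : 'I_n) (j : 'I_(lam i)) : cells lam :=
  @Tagged _ i (fun i => 'I_(lam i)) j.

(** The extension of a filling of cells by zeros. *)
Definition cell_matrix P : {ffun 'I_n * 'I_N -> 'I_M.+1} :=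
  [ffun ij => if insub (val ij.2) is Some j then P (@cell ij.1 j) else ord0].

Lemma cell_matrixE P i (j : 'I_(lam i)) (k : 'I_N) : k = j :> nat ->
  cell_matrix P (i, k) = P (cell j).
Proof. by move=> kj; rewrite ffunE /= kj valK. Qed.

Lemma cell_matrix_out P i (k : 'I_N) : (lam i <= k)%N -> cell_matrix P (i, k) = ord0.
Proof. by move=> lk; rewrite ffunE /= insubF // ltnNge lk. Qed.

Lemma sum_cell_matrix (V : nmodType) (A : pred {ffun 'I_n * 'I_N -> 'I_M.+1}) G :
    (forall p, A p -> forall i (j : 'I_N), (0 < p (i, j))%N -> (j < lam i)%N) ->
  \sum_(P | A (cell_matrix P)) G (cell_matrix P) = \sum_(p | A p) G p :> V.
Proof.
move=> hA; pose rst (p : {ffun 'I_n * 'I_N -> 'I_M.+1}) : {ffun cells lam -> 'I_M.+1} :=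
  [ffun c => p (tag c, widen_ord (lamN (tag c)) (tagged c))].
rewrite [RHS](reindex_onto cell_matrix rst).
  apply: eq_bigl => P; rewrite [_ == _](_ : _ = true) ?andbT //.
  apply/eqP/ffunP => -[i j]; rewrite ffunE /=; exact: cell_matrixE.
move=> p Ap; apply/ffunP => -[i k]; have [ki|ik] := ltnP k (lam i).
  rewrite (@cell_matrixE _ i (Ordinal ki)) // ffunE /=; congr (p (_, _)).
  exact: val_inj.
rewrite cell_matrix_out //; apply/val_inj; apply/esym/eqP; rewrite -leqn0 leqNgt.
by apply: contraL ik => /(hA _ Ap); rewrite ltnNge.
Qed.

Lemma prod_cell_matrix (R : comNzRingType) (y : nat -> R) P : (forall c, 0 < P c)%N ->
  \prod_ij entry_weight y (cell_matrix P ij) = \prod_c y (P c).-1.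
Proof.
move=> P0; rewrite (_ : \prod_ij _ = \prod_i \prod_j entry_weight y (cell_matrix P (i, j))); last first.
  by rewrite pair_bigA; apply: eq_bigr => -[].
transitivity (\prod_i \prod_(j < lam i) y (P (cell j)).-1); last first.
  by rewrite sig_big_dep /=; apply: eq_bigr => -[].
apply: eq_bigr => i _.
pose g k := if insub k is Some j then y (P (@cell i j)).-1 else 1.
transitivity (\prod_(j < lam i) g j); last by apply: eq_bigr => j _; rewrite /g valK.
rewrite (big_ord_widen _ g (lamN i)) [RHS]big_mkcond; apply: eq_bigr => k _.
case: ltnP => [ki|ik]; last by rewrite cell_matrix_out.
rewrite (@cell_matrixE _ i (Ordinal ki)) // /g insubT /=.
by have := P0 (cell (Ordinal ki)); case: (nat_of_ord (P _)).
Qed.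

Lemma filling_cell_matrix (rs cs : bool) (b l : nat -> nat) P :
    (forall i : 'I_n, l i = lam i) -> (forall i k : 'I_n, i <= k -> lam k <= lam i)%N ->
  filling rs cs b l (cell_matrix P) =
  [&& [forall c, 0 < P c],
      [forall c, P c <= b (Defs.row c)],
      [forall c, forall d, (Defs.row c == Defs.row d) && (Defs.col c < Defs.col d) ==> (P d + rs <= P c)]
    & [forall c, forall d, (Defs.col c == Defs.col d) && (Defs.row c < Defs.row d) ==> (P d + cs <= P c)]]%N.
Proof.
move=> hl hlam.
pose w (c : cells lam) : 'I_N := widen_ord (lamN (tag c)) (tagged c).
have pE c : P c = cell_matrix P (tag c, w c).
  by case: c => i j; rewrite (@cell_matrixE _ i j).
apply/fillingP/and4P => [[p0 pb hr hc]|[/forallP p0 /forallP pb /forallP hr /forallP hc]].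
  have pos c : (0 < cell_matrix P (tag c, w c))%N by rewrite p0 hl /= ltn_ord.
  split; apply/forallP => c; rewrite ?pE //.
    apply/forallP => d; apply/implyP => /andP[/eqP/val_inj rcd ccd].
    by rewrite !pE rcd; apply: hr => //; rewrite -rcd in ccd *; apply: pos.
  apply/forallP => d; apply/implyP => /andP[/eqP ccd rcd].
  have wcd : w c = w d by apply: val_inj.
  by rewrite !pE wcd; apply: hc.
split=> [i j|i j|i j k jk|i k j ik].
- have [ji|ij] := ltnP j (lam i); rewrite hl; last by rewrite cell_matrix_out // [RHS]ltnNge ij.
  by rewrite (@cell_matrixE _ i (Ordinal ji)) // ji p0.
- have [ji|ij] := ltnP j (lam i); last by rewrite cell_matrix_out.
  by rewrite (@cell_matrixE _ i (Ordinal ji)) //; apply: pb.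
- have [ki|ik] := ltnP k (lam i); last by rewrite cell_matrix_out.
  rewrite (@cell_matrixE _ i (Ordinal ki)) // (@cell_matrixE _ i (Ordinal (ltn_trans jk ki))) // => _.
  by have /forallP/(_ (cell (Ordinal ki)))/implyP := hr (cell (Ordinal (ltn_trans jk ki))); apply; rewrite eqxx.
- have [jk|kj] := ltnP j (lam k); last by rewrite (@cell_matrix_out _ k).
  have ji := leq_trans jk (hlam _ _ (ltnW ik)).
  rewrite (@cell_matrixE _ k (Ordinal jk)) // (@cell_matrixE _ i (Ordinal ji)) // => _.
  by have /forallP/(_ (cell (Ordinal jk)))/implyP := hc (cell (Ordinal ji)); apply; rewrite eqxx.
Qed.
End CellMatrices.

Lemma is_partition_ext n N (lam : {ffun 'I_n -> 'I_N}) :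
  is_partition (fun i => lam i) = decreasing n (ext lam).
Proof.
apply/forallP/forallP => [h i|h i].
  have [ni|ni] := ltnP i.+1 n; last by rewrite ext_out.
  have /forallP/(_ (Ordinal ni))/implyP := h i.
  by rewrite -!ext_ord; apply => /=.
apply/forallP => j; apply/implyP => ij; rewrite -!ext_ord.
by apply: antitone_seq => //; apply: ext_decreasing => k kn; apply: (h (Ordinal kn)).
Qed.

Lemma prod_ord_double (R : comPzSemiRingType) n (g : nat -> R) :
  \prod_(v < 2 * n) g v = \prod_(i < n) (g (2 * i)%N * g (2 * i).+1).
Proof.
rewrite -(big_mkord xpredT g) -(big_mkord xpredT (fun i => g (2 * i)%N * g (2 * i).+1)).
elim: n => [|n IH]; first by rewrite muln0 !big_geq.
by rewrite mulnS add2n !big_nat_recr //= IH mulrA.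
Qed.

(** Grouping the cells by their entry. *)
Lemma prod_entry_count (R : comNzRingType) n (y : nat -> R) r (lam : 'I_r -> nat)
    (P : cells lam -> 'I_(2 * n).+1) : (forall c, 0 < P c)%N ->
  \prod_c y (P c).-1 =
  \prod_(i < n) (y (2 * i)%N ^+ entry_count (fun c => P c : nat) (2 * i).+1 *
                 y (2 * i).+1 ^+ entry_count (fun c => P c : nat) (2 * i).+2).
Proof.
move=> P0; rewrite (partition_big P predT) //= big_ord_recl /= big1 ?mul1r; last first.
  by move=> c /eqP Pc; have := P0 c; rewrite Pc.
rewrite -(prod_ord_double n (fun k => y k ^+ entry_count (fun c => P c : nat) k.+1)).
apply: eq_bigr => k _; rewrite (eq_bigr (fun=> y k)); last by move=> c /eqP->.
by rewrite prodr_const /entry_count; congr (_ ^+ _); apply: eq_card => c; rewrite [RHS]inE.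
Qed.

Lemma alternate_even (T : Type) (x x' : nat -> T) i : alternate x x' (2 * i) = x i.
Proof. by rewrite /alternate mul2n odd_double doubleK. Qed.

Lemma alternate_odd (T : Type) (x x' : nat -> T) i : alternate x x' (2 * i).+1 = x' i.
Proof. by rewrite /alternate mul2n /= odd_double uphalf_double. Qed.

(** [P] and [Q] only share their shape, so the sum over pairs factors for each
    shape. *)
Lemma pp_gf_fill_sum n (F : fieldType) (u v w : F) (X : nat -> F) : w != 0 ->
  pp_gf u v w (fun i : 'I_n => X i) =
  w ^+ 'C(n.+1, 2) * \prod_(i < n) X i ^+ n.-1 *
  \sum_(lam : {ffun 'I_n -> 'I_n.+1} | decreasing n (ext lam))
    w ^- (\sum_(i < n) ext lam i) *
    fill_sum false true n n (2 * n) (fun i => (n - i).*2)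
      (alternate (fun i => u * X i) (fun i => v * (X i)^-1)) (ext lam) *
    fill_sum true false n n n (fun i => n - i)%N (fun=> 1) (ext lam).
Proof.
move=> w0; rewrite mulr_sumr; apply: eq_big => [lam|lam plam]; first exact: is_partition_ext.
set L : 'I_n -> nat := fun i => lam i.
have LN i : (L i <= n)%N by rewrite -ltnS ltn_ord.
have hL (i k : 'I_n) : (i <= k)%N -> (L k <= L i)%N.
  by have /forallP/(_ i)/forallP/(_ k)/implyP := plam.
have extL (i : 'I_n) : ext lam i = L i by rewrite ext_ord.
pose A (P : {ffun cells L -> 'I_(2 * n).+1}) :=
  filling false true (fun i => (n - i).*2) (ext lam) (cell_matrix n P).
pose B (Q : {ffun cells L -> 'I_n.+1}) :=
  filling true false (fun i => n - i)%N (ext lam) (cell_matrix n Q).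
have AE P : A P = column_strict (fun c => P c) &&
    [forall c, P c <= 2 * row_from_bottom c]%N.
  rewrite /A (filling_cell_matrix LN _ _ _ _ extL hL) /column_strict -!andbA.
  congr (_ && _); rewrite andbC -andbA; congr [&& _, _ & _].
  - by apply: eq_forallb => c; apply: eq_forallb => d; rewrite addn0.
  - by apply: eq_forallb => c; apply: eq_forallb => d; rewrite addn1.
  - by apply: eq_forallb => c; rewrite -mul2n.
have BE Q : B Q = row_strict (fun c => Q c) &&
    [forall c, Q c <= row_from_bottom c]%N.
  rewrite /B (filling_cell_matrix LN _ _ _ _ extL hL) /row_strict -!andbA.
  congr (_ && _); rewrite andbC -andbA; congr [&& _, _ & _].
  - by apply: eq_forallb => c; apply: eq_forallb => d; rewrite addn1.
  - by apply: eq_forallb => c; apply: eq_forallb => d; rewrite addn0.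
transitivity (\sum_(P | A P) pp_weight u v w (fun i : 'I_n => X i) (fun c => P c) *
   \sum_(Q | B Q) 1).
  rewrite [RHS]big_mkcond; apply: eq_bigr => P _; case: ifPn => AP.
    rewrite mulr_sumr; apply: eq_big => [Q|Q _]; last by rewrite mulr1.
    rewrite /is_pp_pair BE; by move: AP; rewrite AE => /andP[-> ->].
  rewrite big_pred0 // => Q; apply: contraNF AP; rewrite AE.
  by case/and4P=> -> _ ->.
rewrite -mulr_suml /fill_sum.
have AL (rs cs : bool) b M (p : {ffun 'I_n * 'I_n -> 'I_M.+1}) : filling rs cs b (ext lam) p ->
    forall i (j : 'I_n), (0 < p (i, j))%N -> (j < L i)%N.
  by case/fillingP => p0 _ _ _ i j; rewrite p0 extL.
rewrite -(sum_cell_matrix LN _ (AL _ _ _ _)) -(sum_cell_matrix LN _ (AL _ _ _ _)).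
rewrite !mulrA; congr (_ * _); last first.
  by apply: eq_bigr => Q _; rewrite big1 // => ij _; case: (nat_of_ord _).
rewrite mulr_sumr; apply: eq_bigr => P AP.
have P0 c : (0 < P c)%N.
  by move: AP; rewrite -/(A P) AE => /andP[/and3P[/forallP/(_ c)]].
rewrite prod_cell_matrix // prod_entry_count // /pp_weight.
have -> : #|{: cells L}| = (\sum_(i < n) ext lam i)%N.
  rewrite -sum1_card; transitivity (\sum_i \sum_(j < L i) 1)%N.
    by rewrite sig_big_dep.
  by apply: eq_bigr => i _; rewrite sum1_card card_ord extL.
rewrite expfzDr // -exprnN -!mulrA; congr (_ * _).
rewrite [RHS]mulrCA; congr (_ * _).
rewrite -big_split; apply: eq_bigr => i _ /=.
by rewrite alternate_even alternate_odd mulrA.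
Qed.

(** * Removing the bottom row of an arrowed monotone triangle *)

Section BottomRow.
Variable n : nat.

Definition top_cell (c : triangle n) : triangle n.+1 :=
  @Tagged _ (widen_ord (leqnSn n) (tag c)) (fun i : 'I_n.+1 => 'I_i.+1) (tagged c).

Definition bottom_cell (j : 'I_n.+1) : triangle n.+1 :=
  @Tagged _ (@ord_max n) (fun i : 'I_n.+1 => 'I_i.+1) j.

Variant triangle_spec : triangle n.+1 -> Type :=
  | TopCell d : triangle_spec (top_cell d)
  | BottomCell j : triangle_spec (bottom_cell j).

Lemma triangleP c : triangle_spec c.
Proof.
case: c => i j; have [ni|ni] := ltnP i n.
  have ei : i = widen_ord (leqnSn n) (Ordinal ni) by apply: val_inj.
  by move: j; rewrite ei => j; apply: (TopCell (@Tagged _ (Ordinal ni) (fun i : 'I_n => 'I_i.+1) j)).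
have ei : i = ord_max by apply/val_inj/eqP; rewrite eqn_leq ni -ltnS ltn_ord.
by move: j; rewrite ei => j; apply: (BottomCell j).
Qed.

Lemma top_cell_inj : injective top_cell.
Proof.
move=> [i j] [i' j'] e.
have ei : i = i'.
  by apply: val_inj; move: (congr1 (fun c => Defs.row c) e).
move: j' e; rewrite -ei => j' /= e; congr (existT _ _ _).
by apply: val_inj; move: (congr1 (fun c => Defs.col c) e).
Qed.

Lemma top_row c : Defs.row (top_cell c) = Defs.row c. Proof. by []. Qed.
Lemma top_col c : Defs.col (top_cell c) = Defs.col c. Proof. by []. Qed.
Lemma bottom_row_index j : Defs.row (bottom_cell j) = n. Proof. by []. Qed.
Lemma bottom_col j : Defs.col (bottom_cell j) = j. Proof. by []. Qed.
Lemma row_lt (c : triangle n) : (Defs.row c < n)%N. Proof. exact: ltn_ord. Qed.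

Lemma top_neq_bottom c j : top_cell c == bottom_cell j = false.
Proof.
by apply/eqP => /(congr1 (fun c => Defs.row c)) /= e; have := row_lt c; rewrite -top_row e ltnn.
Qed.

(** A triangle put together from its upper rows and its bottom row. *)
Definition glue T (g : {ffun triangle n -> T}) (b : {ffun 'I_n.+1 -> T}) :
    {ffun triangle n.+1 -> T} :=
  [ffun c => if [pick d | top_cell d == c] is Some d then g d else b (inord (Defs.col c))].

Lemma glue_top T (g : {ffun triangle n -> T}) b d : glue g b (top_cell d) = g d.
Proof.
rewrite ffunE; case: pickP => [e /eqP/top_cell_inj -> //|/(_ d)].
by rewrite eqxx.
Qed.

Lemma glue_bottom T (g : {ffun triangle n -> T}) b j : glue g b (bottom_cell j) = b j.
Proof.
rewrite ffunE; case: pickP => [e|_]; first by rewrite top_neq_bottom.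
by rewrite bottom_col inord_val.
Qed.

Lemma big_triangle (R : Type) (idx : R) (op : Monoid.com_law idx) (F : triangle n.+1 -> R) :
  \big[op/idx]_c F c =
  op (\big[op/idx]_d F (top_cell d)) (\big[op/idx]_j F (bottom_cell j)).
Proof.
transitivity (\big[op/idx]_(i < n.+1) \big[op/idx]_(j < i.+1) F (@Tagged _ i (fun i : 'I_n.+1 => 'I_i.+1) j)).
  by rewrite sig_big_dep /=; apply: eq_bigr => -[].
rewrite big_ord_recr; congr (op _ _).
by rewrite sig_big_dep /=; apply: eq_bigr => -[].
Qed.

Lemma card_triangle (P : pred (triangle n.+1)) :
  #|[set c | P c]| = (#|[set d | P (top_cell d)]| + #|[set j | P (bottom_cell j)]|)%N.
Proof. by rewrite -!sum1dep_card !(big_mkcond P) big_triangle -!big_mkcond. Qed.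

Lemma sum_glue (V : nmodType) (T : finType) (G : {ffun triangle n.+1 -> T} -> V) :
  \sum_f G f = \sum_(g : {ffun triangle n -> T}) \sum_(b : {ffun 'I_n.+1 -> T}) G (glue g b).
Proof.
rewrite pair_bigA /=.
pose top (f : {ffun triangle n.+1 -> T}) := ([ffun d => f (top_cell d)], [ffun j => f (bottom_cell j)]).
rewrite (reindex (fun gb : {ffun triangle n -> T} * {ffun 'I_n.+1 -> T} => glue gb.1 gb.2)) //.
exists top => [[g b] _|f _] /=.
  by congr (_, _); apply/ffunP => c; rewrite ffunE ?glue_top ?glue_bottom.
by apply/ffunP => c; case: (triangleP c) => d; rewrite ?glue_top ?glue_bottom ffunE.
Qed.

End BottomRow.

Definition int_of n N (m : {ffun triangle n -> 'I_N}) (c : triangle n) : int := (m c : nat)%:Z.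

(** An entry may equal its upper left neighbour only if it carries [NE], and its
    upper right neighbour only if it carries [NW]; these are the gaps that its
    arrow forces otherwise. *)
Definition nw_shift (a : arrow) : nat := a != NE.
Definition ne_shift (a : arrow) : nat := a != NW.

Lemma row_sum_bottom n N (g : {ffun triangle n -> 'I_N}) (l : nat -> nat) :
  bottom_row (fun j => (l j)%:Z) (int_of g) ->
  row_sum (int_of g) n = (\sum_(j < n) l j)%N%:Z.
Proof.
case: n g => [|n] g /forallP gl.
  by rewrite big_ord0 /row_sum big_pred0.
rewrite /row_sum big_mkcond big_triangle /= [X in X + _]big1 ?add0r; last first.
  by move=> d _; rewrite top_row eqSS (ltn_eqF (row_lt d)).
rewrite -[RHS]natz natr_sum; apply: eq_bigr => j _.
by have := gl (bottom_cell j); rewrite bottom_row_index bottom_col eqxx natz => /eqP.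
Qed.

Section Glue.
Variables (n N : nat) (g : {ffun triangle n -> 'I_N}) (k : {ffun 'I_n.+1 -> 'I_N}).
Variables (a : {ffun triangle n -> arrow}) (b : {ffun 'I_n.+1 -> arrow}).
Variable l : nat -> nat.
Hypothesis gl : bottom_row (fun j => (l j)%:Z) (int_of g).

Lemma bottom_entry (d : triangle n) : (Defs.row d).+1 = n -> g d = l (Defs.col d) :> nat.
Proof. by move=> rd; have /forallP/(_ d)/implyP := gl; rewrite rd eqxx => /(_ isT)/eqP[]. Qed.

Lemma exists_bottom_cell (j : 'I_n) : exists2 d : triangle n, (Defs.row d).+1 = n & Defs.col d = j.
Proof. by case: n j => [[]//|n' j]; exists (bottom_cell j). Qed.

(** Once the bottom arrows [b] are fixed, the conditions between the last two
    rows confine every entry of the upper one to an interval.  Strict increase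
    of that row is part of [is_amt (int_of g) a]. *)
Lemma is_amt_glue :
  (forall i j : 'I_n.+1, i < j -> k i < k j)%N ->
  is_amt (int_of (glue g k)) (glue a b) =
  is_amt (int_of g) a &&
  [forall j : 'I_n, (k (lift ord_max j) + ne_shift (b (lift ord_max j)) <= l j)%N &&
                    (l j + nw_shift (b (lift ord0 j)) <= k (lift ord0 j))%N].
Proof.
move=> hk.
have lmax (j : 'I_n) : lift ord_max j = j :> nat by apply: lift_max.
have l0 (j : 'I_n) : lift ord0 j = j.+1 :> nat by [].
apply/idP/idP.
  case/andP => /and3P[/forallP h1 /forallP h2 /forallP h3] /andP[/forallP h4 /forallP h5].
  apply/andP; split.
    apply/andP; split; [apply/and3P; split | apply/andP; split]; apply/forallP => c; apply/forallP => d.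
    - have /forallP/(_ (top_cell d)) := h1 (top_cell c).
      by rewrite /int_of !glue_top.
    - have /forallP/(_ (top_cell d)) := h2 (top_cell c).
      by rewrite /int_of !glue_top.
    - have /forallP/(_ (top_cell d)) := h3 (top_cell c).
      by rewrite /int_of !glue_top.
    - have /forallP/(_ (top_cell d)) := h4 (top_cell c).
      by rewrite /int_of !glue_top.
    - have /forallP/(_ (top_cell d)) := h5 (top_cell c).
      by rewrite /int_of !glue_top.
  apply/forallP => j; have [d rd cd] := exists_bottom_cell j.
  have gd : g d = l j :> nat by rewrite bottom_entry // cd.
  have ne : ne_neighbor (bottom_cell (lift ord_max j)) (top_cell d).
    by rewrite /ne_neighbor top_row top_col bottom_row_index bottom_col rd cd lmax !eqxx.
  have nw : nw_neighbor (bottom_cell (lift ord0 j)) (top_cell d).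
    by rewrite /nw_neighbor top_row top_col bottom_row_index bottom_col rd cd !eqxx.
  apply/andP; split.
    have /forallP/(_ (top_cell d))/implyP/(_ ne) := h1 (bottom_cell (lift ord_max j)).
    have /forallP/(_ (top_cell d)) := h5 (bottom_cell (lift ord_max j)).
    rewrite ne /int_of glue_top !glue_bottom gd lez_nat /= /ne_shift.
    case: (b _ =P NW) => [_ _|_]; first by rewrite addn0.
    by rewrite implybF => neq le; rewrite addn1 ltn_neqAle le andbT eq_sym.
  have /forallP/(_ (top_cell d))/implyP/(_ nw) := h2 (bottom_cell (lift ord0 j)).
  have /forallP/(_ (top_cell d)) := h4 (bottom_cell (lift ord0 j)).
  rewrite nw /int_of glue_top !glue_bottom gd lez_nat /= /nw_shift.
  case: (b _ =P NE) => [_ _|_]; first by rewrite addn0.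
  by rewrite implybF => neq le; rewrite addn1 ltn_neqAle le andbT.
case/andP => /andP[/and3P[/forallP h1 /forallP h2 /forallP h3] /andP[/forallP h4 /forallP h5]] /forallP h.
have ne_bottom j e : ne_neighbor (bottom_cell j) (top_cell e) ->
    exists2 i : 'I_n, j = lift ord_max i & g e = l i :> nat.
  rewrite /ne_neighbor top_row top_col bottom_row_index bottom_col => /andP[/eqP re /eqP ce].
  have hi : (j < n)%N by rewrite ce [X in (_ < X)%N]re ltn_ord.
  exists (Ordinal hi); first by apply: val_inj; apply: esym; apply: lmax.
  by rewrite bottom_entry -?re // -ce.
have nw_bottom j e : nw_neighbor (bottom_cell j) (top_cell e) ->
    exists2 i : 'I_n, j = lift ord0 i & g e = l i :> nat.
  rewrite /nw_neighbor top_row top_col bottom_row_index bottom_col => /andP[/eqP re /eqP ce].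
  have hi : (Defs.col e < n)%N by rewrite [X in (_ < X)%N]re ltn_ord.
  exists (Ordinal hi); first by apply: val_inj.
  by rewrite bottom_entry -?re.
have no_top_bottom (d : triangle n) j p : (Defs.row (top_cell d) == (Defs.row (@bottom_cell n j)).+1) && p = false.
  by rewrite top_row bottom_row_index (ltn_eqF (leqW (row_lt d))).
have no_bottom_bottom i j p : (Defs.row (@bottom_cell n i) == (Defs.row (@bottom_cell n j)).+1) && p = false.
  by rewrite !bottom_row_index ltn_eqF.
apply/andP; split; [apply/and3P; split | apply/andP; split];
  apply/forallP => c; apply/forallP => d; apply/implyP;
  case: (triangleP c) => {}c; case: (triangleP d) => {}d.
- by move=> cd; have /forallP/(_ d)/implyP := h1 c; rewrite /int_of !glue_top; apply.
- by rewrite /ne_neighbor no_top_bottom.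
- move=> /ne_bottom[i -> gd]; rewrite /int_of glue_top glue_bottom gd lez_nat.
  by have /andP[+ _] := h i; apply: leq_trans; apply: leq_addr.
- by rewrite /ne_neighbor no_bottom_bottom.
- by move=> cd; have /forallP/(_ d)/implyP := h2 c; rewrite /int_of !glue_top; apply.
- by rewrite /nw_neighbor no_top_bottom.
- move=> /nw_bottom[i -> gd]; rewrite /int_of glue_top glue_bottom gd lez_nat.
  by have /andP[_] := h i; apply: leq_trans; apply: leq_addr.
- by rewrite /nw_neighbor no_bottom_bottom.
- by move=> cd; have /forallP/(_ d)/implyP := h3 c; rewrite /int_of !glue_top; apply.
- by rewrite top_row bottom_row_index (ltn_eqF (row_lt _)).
- by rewrite top_row bottom_row_index (gtn_eqF (row_lt _)).
- move=> /andP[_ /eqP cd]; rewrite /int_of !glue_bottom ltz_nat; apply: hk.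
  by rewrite !bottom_col in cd; rewrite cd.
- by move=> cd; have /forallP/(_ d)/implyP := h4 c; move: cd; rewrite /int_of !glue_top => cd; apply.
- by rewrite /nw_neighbor no_top_bottom.
- case/andP=> /nw_bottom[i -> gd]; rewrite /int_of glue_top !glue_bottom gd => /eqP[lk].
  have /andP[_] := h i; rewrite lk /nw_shift; case: (b _ == NE) => //.
  by rewrite addn1 ltnn.
- by rewrite /nw_neighbor no_bottom_bottom.
- by move=> cd; have /forallP/(_ d)/implyP := h5 c; move: cd; rewrite /int_of !glue_top => cd; apply.
- by rewrite /ne_neighbor no_top_bottom.
- case/andP=> /ne_bottom[i -> gd]; rewrite /int_of glue_top !glue_bottom gd => /eqP[lk].
  have /andP[+ _] := h i; rewrite lk /ne_shift; case: (b _ == NW) => //.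
  by rewrite addn1 ltnn.
- by rewrite /ne_neighbor no_bottom_bottom.
Qed.

Lemma bottom_row_glue (l' : nat -> nat) :
  bottom_row (fun j => (l' j)%:Z) (int_of (glue g k)) = [forall j, k j == l' j :> nat].
Proof.
apply/forallP/forallP => h c.
  by have := h (bottom_cell c); rewrite bottom_row_index eqxx /int_of glue_bottom.
case: (triangleP c) => {}c; last by rewrite /int_of glue_bottom; apply/implyP => _; apply: h.
by rewrite top_row eqSS (ltn_eqF (row_lt _)).
Qed.

Definition arrow_weight (R : unitRingType) (u v w x : R) (d : arrow) : R :=
  match d with NE => u * x | NW => v * x^-1 | NWNE => w end.

Lemma amt_weight_glue (F : fieldType) (u v w : F) (X : nat -> F) : X n != 0 ->
  amt_weight u v w (fun i : 'I_n.+1 => X i) (int_of (glue g k)) (glue a b) =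
  (\prod_j arrow_weight u v w (X n) (b j)) *
  (X n ^ ((\sum_j (k j : nat))%N%:Z - (\sum_(j < n) l j)%N%:Z) *
   amt_weight u v w (fun i : 'I_n => X i) (int_of g) a).
Proof.
move=> X0; rewrite /amt_weight.
have cnt x : arrow_count (glue a b) x = (arrow_count a x + #|[set j | b j == x]|)%N.
  rewrite /arrow_count card_triangle; congr (_ + _)%N; apply: eq_card => c; rewrite !inE.
    by rewrite glue_top.
  by rewrite glue_bottom.
have rcnt x (i : 'I_n) : row_arrow_count (glue a b) x i.+1 = row_arrow_count a x i.+1.
  rewrite /row_arrow_count card_triangle [X in (_ + X)%N](_ : _ = 0%N) ?addn0.
    by apply: eq_card => c; rewrite !inE top_row glue_top.
  apply/eqP; rewrite cards_eq0; apply/eqP/setP => j; rewrite !inE.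
  by rewrite bottom_row_index eqSS gtn_eqF.
have rcntn x : row_arrow_count (glue a b) x n.+1 = #|[set j | b j == x]|.
  rewrite /row_arrow_count card_triangle [X in (X + _)%N](_ : _ = 0%N) ?add0n.
    by apply: eq_card => c; rewrite !inE bottom_row_index eqxx glue_bottom.
  apply/eqP; rewrite cards_eq0; apply/eqP/setP => j; rewrite !inE.
  by rewrite top_row eqSS (ltn_eqF (row_lt _)).
have rs i : (i <= n)%N -> row_sum (int_of (glue g k)) i = row_sum (int_of g) i.
  move=> ni; rewrite /row_sum big_mkcond big_triangle /= [X in _ + X]big1 ?addr0; last first.
    by move=> j _; rewrite bottom_row_index gtn_eqF.
  by rewrite [RHS]big_mkcond; apply: eq_bigr => d _; rewrite top_row /int_of glue_top.
have rsk : row_sum (int_of (glue g k)) n.+1 = (\sum_j (k j : nat))%N%:Z.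
  rewrite /row_sum big_mkcond big_triangle /= [X in X + _]big1 ?add0r; last first.
    by move=> d _; rewrite top_row eqSS (ltn_eqF (row_lt _)).
  rewrite -[RHS]natz natr_sum; apply: eq_bigr => j _.
  by rewrite bottom_row_index eqxx /int_of glue_bottom natz.
have rsl : row_sum (int_of g) n = (\sum_(j < n) l j)%N%:Z.
  exact: row_sum_bottom gl.
rewrite big_ord_recr /= (rs n) // rsk rsl !rcntn !cnt.
have rsi (i : 'I_n) : row_sum (int_of (glue g k)) i = row_sum (int_of g) i.
  by rewrite rs // ltnW.
have rsS (i : 'I_n) : row_sum (int_of (glue g k)) i.+1 = row_sum (int_of g) i.+1.
  by rewrite rs.
under eq_bigr do rewrite rsS rsi !rcnt.
have -> : \prod_j arrow_weight u v w (X n) (b j) =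
    (u * X n) ^+ #|[set j | b j == NE]| * (v * (X n)^-1) ^+ #|[set j | b j == NW]| *
    w ^+ #|[set j | b j == NWNE]|.
  rewrite -!prodr_const !(big_mkcond (fun j => j \in _)) -!big_split.
  apply: eq_bigr => j _ /=; rewrite !inE.
  by case: (b j); rewrite !eqxx /= ?mul1r ?mulr1.
rewrite !expfzDr // -!exprnN -!exprnP !exprD !exprMn exprVn.
by ring.
Qed.

End Glue.

Lemma bottom_row_unique n N (g : {ffun triangle n -> 'I_N}) :
  exists l0 : {ffun 'I_n -> 'I_N}, forall l : {ffun 'I_n -> 'I_N},
    bottom_row (fun j => (ext l j)%:Z) (int_of g) = (l == l0).
Proof.
case: n g => [|n] g.
  have no (T : Type) (i : 'I_0) : T by case: i.
  exists [ffun i => no _ i] => l; transitivity true.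
    by apply/forallP => -[[]].
  by apply/esym/eqP/ffunP => -[].
exists [ffun j => g (bottom_cell j)] => l; apply/forallP/eqP => [h|-> c].
  apply/ffunP => j; rewrite ffunE; apply/val_inj.
  have := h (bottom_cell j); rewrite bottom_row_index eqxx bottom_col ext_ord.
  by move=> /eqP[].
case: (triangleP c) => {}c; first by rewrite top_row eqSS (ltn_eqF (row_lt c)).
by apply/implyP => _; rewrite bottom_col ext_ord ffunE.
Qed.

Section AmtSum.
Variables (F : fieldType) (u v w : F) (N : nat) (X : nat -> F).

Definition amt_sum n (k : nat -> nat) : F :=
  \sum_(m : {ffun triangle n -> 'I_N})
  \sum_(a : {ffun triangle n -> arrow} |
      is_amt (int_of m) a && bottom_row (fun j => (k j)%:Z) (int_of m))
    amt_weight u v w (fun i : 'I_n => X i) (int_of m) a.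

(** The sum over the triangles with one more row, split by the bottom arrows [b]
    and by the last row but one, [l]. *)
Lemma amt_sum_recurrence n (k : nat -> nat) : X n != 0 ->
    (forall i, i < n -> k i < k i.+1)%N -> (k n < N)%N ->
  amt_sum n.+1 k =
  \sum_(b : {ffun 'I_n.+1 -> arrow}) (\prod_j arrow_weight u v w (X n) (b j)) *
    \sum_(l : {ffun 'I_n -> 'I_N} |
        [forall j : 'I_n, (k j + ne_shift (b (lift ord_max j)) <= ext l j)%N &&
                          (ext l j + nw_shift (b (lift ord0 j)) <= k j.+1)%N])
      X n ^ ((\sum_(j < n.+1) k j)%N%:Z - (\sum_(j < n) ext l j)%N%:Z) *
      amt_sum n (ext l).
Proof.
move=> X0 kS kN.
have k_lt i j : (i < j)%N -> (j <= n)%N -> (k i < k j)%N.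
  elim: j => // j IH; rewrite ltnS leq_eqVlt => /orP[/eqP<-|ij] jn; first exact: kS.
  exact: ltn_trans (IH ij (ltnW jn)) (kS _ jn).
have k_le j : (j < n.+1)%N -> (k j < N)%N.
  rewrite ltnS leq_eqVlt => /orP[/eqP->//|jn].
  exact: ltn_trans (k_lt _ _ jn (leqnn n)) kN.
(* The bottom row is prescribed, so it is not summed over. *)
pose k0 : {ffun 'I_n.+1 -> 'I_N} := [ffun j : 'I_n.+1 => Ordinal (k_le j (ltn_ord j))].
have k0E j : k0 j = k j :> nat by rewrite ffunE.
have k0_lt (i j : 'I_n.+1) : (i < j -> k0 i < k0 j)%N.
  by rewrite !k0E => ij; apply: k_lt => //; rewrite -ltnS.
pose A b (l : {ffun 'I_n -> 'I_N}) := [forall j : 'I_n,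
   (k j + ne_shift (b (lift ord_max j)) <= ext l j)%N &&
   (ext l j + nw_shift (b (lift ord0 j)) <= k j.+1)%N].
transitivity (\sum_(g : {ffun triangle n -> 'I_N}) \sum_(a : {ffun triangle n -> arrow})
  \sum_(b : {ffun 'I_n.+1 -> arrow}) \sum_(l : {ffun 'I_n -> 'I_N})
   if [&& A b l, is_amt (int_of g) a & bottom_row (fun j => (ext l j)%:Z) (int_of g)] then
    (\prod_j arrow_weight u v w (X n) (b j)) *
    (X n ^ ((\sum_(j < n.+1) k j)%N%:Z - (\sum_(j < n) ext l j)%N%:Z) *
     amt_weight u v w (fun i : 'I_n => X i) (int_of g) a) else 0).
  rewrite /amt_sum sum_glue; apply: eq_bigr => g _.
  rewrite (bigD1 k0) //= [X in _ + X]big1 ?addr0; last first.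
    move=> k1 nk; rewrite big_pred0 // => a; apply: contraNF nk => /andP[_].
    rewrite bottom_row_glue => /forallP h; apply/eqP/ffunP => j; apply/val_inj.
    by rewrite /= k0E (eqP (h j)).
  rewrite big_mkcond sum_glue; apply: eq_bigr => a _; apply: eq_bigr => b _.
  (* Of all the [l] only the last row of [g] itself contributes. *)
  have [l0 hl0] := bottom_row_unique g.
  have gl0 : bottom_row (fun j => (ext l0 j)%:Z) (int_of g) by rewrite hl0.
  rewrite [RHS](bigD1 l0) //= [X in _ = _ + X]big1 ?addr0; last first.
    by move=> l nl; rewrite hl0 (negbTE nl) !andbF.
  rewrite bottom_row_glue (is_amt_glue _ _ gl0 k0_lt) gl0.
  rewrite (amt_weight_glue _ _ _ gl0 u v w X0).
  have -> : [forall j, k0 j == k j :> nat] by apply/forallP => j; rewrite k0E.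
  rewrite !andbT andbC; congr (if _ && _ then _ * (X n ^ (_ - _) * _) else _).
    by apply: eq_forallb => j; rewrite !k0E lift_max.
  by congr (Posz _); apply: eq_bigr => j _; rewrite k0E.
under eq_bigr do rewrite exchange_big.
rewrite exchange_big; apply: eq_bigr => b _; rewrite mulr_sumr [RHS]big_mkcond.
under eq_bigr do rewrite exchange_big.
rewrite exchange_big; apply: eq_bigr => l _ /=; rewrite -/(A b l).
case: (A b l); last by rewrite big1 // => g _; rewrite big1.
rewrite !mulr_sumr; apply: eq_bigr => g _.
rewrite !mulr_sumr [RHS]big_mkcond; apply: eq_bigr => a _.
by case: ifP.
Qed.
End AmtSum.

(** * Cancellation and bookkeeping for endpoint choices *)

(** Composition with [t] pairs even and odd permutations. *)
Lemma antisym_sum_eq0 (R : pzRingType) n (t : 'S_n) (G : 'S_n -> R) : odd_perm t ->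
  (forall s, G (t * s)%g = G s) -> \sum_(s : 'S_n) (-1) ^+ s * G s = 0.
Proof.
move=> ot Gt; rewrite (bigID (fun s => odd_perm s)) /=.
rewrite (reindex_inj (mulgI t)) /=.
rewrite (eq_bigl (fun s => ~~ odd_perm s)) => [|s]; last by rewrite odd_permM ot.
rewrite -big_split big1 //= => s ns.
by rewrite odd_permM ot (negbTE ns) Gt expr1 expr0 mul1r mulN1r addNr.
Qed.

(** Expanding the product of the sums [P j + Q j], where [P j] depends on
    [b j] and [Q j] on [b (j + 1)], and then summing over every [b i] separately:
    for each choice [c] of summands, [b i] occurs in at most two of them. *)
Lemma sum_prod_links (R : comNzRingType) (T : finType) n (f : 'I_n.+1 -> T -> R)
    (P Q : 'I_n -> T -> R) :
  \sum_(b : {ffun 'I_n.+1 -> T}) (\prod_i f i (b i)) *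
    \prod_(j < n) (P j (b (lift ord_max j)) + Q j (b (lift ord0 j)))
  = \sum_(c : {ffun 'I_n -> bool}) \prod_(i < n.+1) \sum_(d : T) f i d *
      (oapp (fun j => if c j then P j d else 1) 1 (unlift ord_max i) *
       oapp (fun j => if c j then 1 else Q j d) 1 (unlift ord0 i)).
Proof.
under [RHS]eq_bigr do rewrite bigA_distr_bigA.
rewrite [RHS]exchange_big; apply: eq_bigr => b _ /=.
under [RHS]eq_bigr do rewrite big_split /=.
rewrite -mulr_sumr; congr (_ * _).
transitivity (\prod_(j < n) \sum_(e : bool)
    (if e then P j (b (lift ord_max j)) else Q j (b (lift ord0 j)))).
  by apply: eq_bigr => j _; rewrite big_bool.
rewrite bigA_distr_bigA; apply: eq_bigr => c _; rewrite big_split /=.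
rewrite [X in _ = X * _](bigD1_ord ord_max) //= unlift_none mul1r.
rewrite [X in _ = _ * X](bigD1_ord ord0) //= unlift_none mul1r -big_split.
by apply: eq_bigr => j _ /=; rewrite !liftK /=; case: (c j); rewrite ?mulr1 ?mul1r.
Qed.

(** The choices that start with [m] times true and continue with false. *)
Definition threshold n (m : nat) : {ffun 'I_n -> bool} := [ffun j : 'I_n => (j < m)%N].

Definition adjacent_ascent n (c : {ffun 'I_n -> bool}) : Prop :=
  exists i j : 'I_n, [/\ j = i.+1 :> nat, ~~ c i & c j].

(** A choice that is not a threshold has a false immediately followed by a true. *)
Lemma sum_threshold (V : zmodType) n (H : {ffun 'I_n -> bool} -> V) :
  (forall c, adjacent_ascent c -> H c = 0) ->
  \sum_c H c = \sum_(m < n.+1) H (threshold n m).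
Proof.
move=> H0; pose P (c : {ffun 'I_n -> bool}) :=
  [forall j : 'I_n, forall k : 'I_n, (j < k)%N && c k ==> c j].
have Pc c : P c -> threshold n #|[pred j : 'I_n | c j]| = c.
  move=> /forallP hc; apply/ffunP => j; rewrite ffunE; apply: (@count_down_closed n [pred j | c j]).
  by move=> {}j k jk ck; have /forallP/(_ k)/implyP := hc j; apply; rewrite jk.
rewrite (bigID P) /= [X in _ + X]big1 ?addr0.
  rewrite (reindex_onto (fun m : 'I_n.+1 => threshold n m) (fun c => inord #|[pred j : 'I_n | c j]|)) /=.
    apply: eq_bigl => m; have PP : P (threshold n m).
      apply/forallP => j; apply/forallP => k; apply/implyP; rewrite !ffunE.
      by case/andP=> jk; apply: ltn_trans.
    rewrite PP /=; apply/eqP/val_inj; rewrite /= inordK; last first.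
      by rewrite ltnS -[X in (_ <= X)%N]card_ord max_card.
    apply: (@eq_from_lt_ord n) => [||j].
    - by rewrite -[X in (_ <= X)%N]card_ord max_card.
    - by rewrite -ltnS.
    by have /ffunP/(_ j) := Pc _ PP; rewrite !ffunE.
  move=> c Pcc; rewrite inordK ?Pc //.
  by rewrite ltnS -[X in (_ <= X)%N]card_ord max_card.
move=> c /forallPn[j /forallPn[k]]; rewrite negb_imply -andbA => /and3P[jk ck cj].
apply: H0; elim: {k}(k - j)%N {-2}k (erefl (k - j)%N) jk ck => [|d IH] k dk jk ck.
  by move: jk; rewrite -subn_gt0 dk.
have kn : (k.-1 < n)%N by apply: leq_ltn_trans (leq_pred _) (ltn_ord k).
have k0 : (0 < k)%N by apply: leq_ltn_trans jk.
case ck' : (c (Ordinal kn)); last first.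
  by exists (Ordinal kn), k; rewrite ck' ck /= prednK.
have [jk'|] := ltnP j k.-1; last first.
  rewrite -ltnS prednK // => kj; exists j, k; split=> //.
  by apply/eqP; rewrite eqn_leq kj jk.
by apply: (IH (Ordinal kn)) => //=; rewrite -subn1 subnAC dk subn1.
Qed.

Lemma sum_arrow (V : zmodType) (f : arrow -> V) : \sum_d f d = f NE + f NW + f NWNE.
Proof.
rewrite (bigD1 NE) // (bigD1 NW) // (bigD1 NWNE) //= big1 ?addr0 ?addrA //.
by case.
Qed.

(** * The operator formula for arrowed monotone triangles *)

Lemma prod_lt_recr (R : comPzSemiRingType) r (f : nat -> nat -> R) :
  \prod_(i < r.+1) \prod_(j < r.+1 | (i < j)%N) f i j =
  \prod_(i < r) f i r * \prod_(i < r) \prod_(j < r | (i < j)%N) f i j.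
Proof.
rewrite big_ord_recr /= [X in _ * X]big_pred0 ?mulr1 => [|j]; last by rewrite ltnNge -ltnS ltn_ord.
rewrite -big_split; apply: eq_bigr => i _ /=.
rewrite big_mkcond big_ord_recr /= ltn_ord mulrC [in RHS]big_mkcond.
by [].
Qed.

Section OperatorFormula.
Variables (F : fieldType) (u v w : F).

(** The symbol of the operator [u E_p + v E_q^-1 + w E_p E_q^-1] which acts on the
    entries [k_p] and [k_q] of the bottom row by shifts. *)
Definition pair_factor (a b : F) : F := u * a + v * b^-1 + w * a * b^-1.

Definition operator_term n (k : nat -> nat) (x : 'I_n -> F) : F :=
  (\prod_(p < n) \prod_(q < n | (p < q)%N) pair_factor (x p) (x q)) *
  \prod_(i < n) x i ^+ (k i + i).

Definition operator_sum n (k : nat -> nat) (X : nat -> F) : F :=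
  \sum_(s : 'S_n) (-1) ^+ s * operator_term k (fun i => X (s i)).

Lemma shiftE :
  ((ne_shift NE = 1%N) * (ne_shift NW = 0%N) * (ne_shift NWNE = 1%N) *
   (nw_shift NE = 0%N) * (nw_shift NW = 1%N) * (nw_shift NWNE = 1%N))%type.
Proof. by []. Qed.

Section LastVariable.
Variables (n : nat) (y : F) (k : nat -> nat).
Hypothesis y0 : y != 0.

(** For variables [x] of the upper rows and [y] of the new row, the geometric sum
    over the j-th entry of the last row but one has a lower endpoint (chosen by
    [c j]), which involves the j-th bottom entry and its arrow, and an upper one,
    which involves the next bottom entry.  The factor collects what belongs to
    the i-th bottom entry, summed over its arrows. *)
Definition endpoint_factor (c : {ffun 'I_n -> bool}) (x : 'I_n -> F) (i : 'I_n.+1) : F :=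
  \sum_(d : arrow) arrow_weight u v w y d * y ^+ k i *
    (oapp (fun j => if c j then y * (x j / y) ^+ (k i + ne_shift d) else 1) 1 (unlift ord_max i) *
     oapp (fun j => if c j then 1 else - (y * (x j / y) ^+ ((k i).+1 - nw_shift d))) 1
       (unlift ord0 i)).

Lemma sum_arrow_endpoints (x : 'I_n -> F) :
  \sum_(b : {ffun 'I_n.+1 -> arrow}) (\prod_i (arrow_weight u v w y (b i) * y ^+ k i)) *
    \prod_(j < n) (y * (x j / y) ^+ (k j + ne_shift (b (lift ord_max j))) -
                   y * (x j / y) ^+ ((k j.+1).+1 - nw_shift (b (lift ord0 j))))
  = \sum_c \prod_i endpoint_factor c x i.
Proof.
rewrite /endpoint_factor.
pose f (i : 'I_n.+1) d := arrow_weight u v w y d * y ^+ k i.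
pose P (j : 'I_n) d := y * (x j / y) ^+ (k j + ne_shift d).
pose Q (j : 'I_n) d := - (y * (x j / y) ^+ ((k j.+1).+1 - nw_shift d)).
rewrite (sum_prod_links f P Q); apply: eq_bigr => c _; apply: eq_bigr => i _.
apply: eq_bigr => d _; congr (_ * (_ * _)).
  by case: unliftP => //= j ->; rewrite lift_max.
by case: unliftP => //= j ->.
Qed.

Lemma pair_factor_swap a b : a != 0 -> b != 0 ->
  pair_factor a b * b = u * a * b + v + w * a.
Proof. by move=> a0 b0; rewrite /pair_factor; field. Qed.

(** The upper endpoint of the i-th sum and the lower endpoint of the next one
    belong to the same bottom entry.  Their common factor and the pair factor of
    [x i] and [x j] are, up to symmetric terms, [u x_i x_j + v + w x_j] and
    [u x_i x_j + v + w x_i]; so exchanging [x i] and [x j] changes nothing. *)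
Lemma endpoint_ascent_antisym (c : {ffun 'I_n -> bool}) (x : 'I_n -> F) (i j : 'I_n) :
    (forall i, x i != 0) -> j = i.+1 :> nat -> ~~ c i -> c j ->
  operator_term (fun=> 0%N) (fun p => x (tperm i j p)) *
    \prod_p endpoint_factor c (fun p => x (tperm i j p)) p
  = operator_term (fun=> 0%N) x * \prod_p endpoint_factor c x p.
Proof.
move=> x0 ji ci cj; set t := tperm i j.
have ij : (i < j)%N by rewrite ji.
have nij : i != j by rewrite -val_eqE ltn_eqF.
(* [rest] is what remains after taking out the pair [(i, j)], one power of [z j],
   and the factor of the bottom entry shared by the two endpoints. *)
pose rest (z : 'I_n -> F) :=
  (\prod_(pq : 'I_n * 'I_n | (pq.1 < pq.2)%N && (pq != (i, j))) pair_factor (z pq.1) (z pq.2)) *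
  \prod_p z p ^+ (p - (p == j))%N *
  \prod_(p | p != lift ord0 i) endpoint_factor c z p.
have split_term (z : 'I_n -> F) :
    operator_term (fun=> 0%N) z * \prod_p endpoint_factor c z p =
    rest z * (pair_factor (z i) (z j) * z j * endpoint_factor c z (lift ord0 i)).
  rewrite /operator_term /rest pair_big_dep /= (bigD1 (i, j)) //=.
  rewrite [X in _ * X = _](bigD1 (lift ord0 i)) //=.
  rewrite [X in _ * X * _ = _](bigD1 j) //= [X in _ = _ * X * _ * _](bigD1 j) //=.
  rewrite eqxx add0n -{1}(prednK (leq_ltn_trans (leq0n i) ij)) exprS subn1.
  rewrite [X in _ * (_ * X) * _](eq_bigr (fun p => z p ^+ (p - (p == j)))); last first.
    by move=> p /negbTE->; rewrite subn0.
  by ring.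
rewrite !split_term; congr (_ * _).
  rewrite /rest; congr (_ * _ * _).
  - rewrite [RHS](reindex_onto (fun pq => (t pq.1, t pq.2)) (fun pq => (t pq.1, t pq.2))) /=; last first.
      by move=> [p q] _; rewrite /= /t !tpermK.
    apply: eq_bigl => -[p q] /=; rewrite /t !tpermK eqxx andbT !xpair_eqE.
    rewrite -!(inj_eq val_inj) /=.
    case: (tpermP i j p) => [->|->|/eqP + /eqP]; case: (tpermP i j q) => [->|->|/eqP + /eqP];
      rewrite -?(inj_eq val_inj) /= ?ji; clear; lia.
  - rewrite [RHS](reindex_perm t); apply: eq_bigr => p _; congr (_ ^+ _).
    rewrite /t; case: tpermP => [->|->|/eqP ni /eqP nj] //; rewrite ?eqxx ?(negbTE nij) ?ji.
      by rewrite subn0 subn1.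
    by rewrite subn0 subn1.
  apply: eq_bigr => p np; apply: eq_bigr => d _; congr (_ * (_ * _)).
    case: unliftP => //= p' ep; case cp : (c p') => //; congr (_ * (_ / _) ^+ _).
    rewrite tpermD //; first by apply: contraNneq ci => ->.
    apply: contraNneq np => jp; rewrite ep -jp.
    by apply/eqP/val_inj/(etrans (lift_max _)).
  case: unliftP => //= p' ep; case cp : (c p') => //; congr (- (_ * (_ / _) ^+ _)).
  rewrite tpermD //; first by apply: contraNneq np => ip; rewrite ep -ip.
  by apply: contraTneq cj => ->; rewrite cp.
rewrite !tpermL !tpermR.
have e_i z : endpoint_factor c z (lift ord0 i) = \sum_(d : arrow) arrow_weight u v w y d * y ^+ k j *
   (y * (z j / y) ^+ (k j + ne_shift d) * - (y * (z i / y) ^+ ((k j).+1 - nw_shift d))).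
  have e : lift ord0 i = lift ord_max j.
    by apply/val_inj/(etrans (esym ji))/esym/lift_max.
  rewrite /endpoint_factor liftK [in unlift ord_max _]e liftK /= (negbTE ci) cj.
  by rewrite (_ : bump 0 i = j).
rewrite !e_i !sum_arrow /= tpermL tpermR !shiftE !addn1 !addn0 !subn0 !subn1 /=.
rewrite !pair_factor_swap // !exprS.
set A := (x i / y) ^+ k j; set B := (x j / y) ^+ k j.
by field.
Qed.
(** The m-th bottom entry occurs in no endpoint and yields the factor of [y]; it
    becomes the place of [y] among the variables.  Every other bottom
    entry occurs in one endpoint and yields the pair factor with [y]. *)
Lemma endpoint_threshold (m : 'I_n.+1) (x : 'I_n -> F) : (forall i, x i != 0) ->
  operator_term (fun=> 0%N) x * \prod_p endpoint_factor (threshold n m) x p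
  = (-1) ^+ (m + n) * (u * y + v * y^-1 + w) *
    operator_term k (fun i : 'I_n.+1 => oapp x y (unlift m i)).
Proof.
move=> x0; have lift_lt (i j : 'I_n) : (lift m i < lift m j)%N = (i < j)%N.
  by rewrite /= /bump; case: (leqP m i); case: (leqP m j); clear; lia.
have lift_m (i : 'I_n) : (lift m i < m)%N = (i < m)%N.
  by rewrite /= /bump; case: (leqP m i); clear; lia.
have m_lift (i : 'I_n) : (m < lift m i)%N = (m <= i)%N.
  by rewrite /= /bump; case: (leqP m i); clear; lia.
have at_m : endpoint_factor (threshold n m) x m = (u * y + v * y^-1 + w) * y ^+ k m.
  rewrite /endpoint_factor (eq_bigr (fun d => arrow_weight u v w y d * y ^+ k m)) => [|d _].
    by rewrite sum_arrow /=; ring.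
  rewrite [X in _ * (X * _)](_ : _ = 1); last first.
    case: unliftP => //= j mj; rewrite ffunE.
    by rewrite ltnNge -{1}(lift_max j) -mj leqnn.
  rewrite [X in _ * (_ * X)](_ : _ = 1) ?mulr1 //.
  case: unliftP => //= j mj; rewrite ffunE.
  by rewrite [X in (_ < X)%N](congr1 val mj) /= ltnS leqnn.
have at_lift j : endpoint_factor (threshold n m) x (lift m j) =
    (if (j < m)%N then y else -1) * (if (m <= j)%N then pair_factor y (x j) else 1) *
    (if (j < m)%N then pair_factor (x j) y else 1) *
    x j ^+ (k (lift m j) + (m <= j)).
  rewrite /endpoint_factor; case: (ltnP j m) => jm.
    have ej : lift m j = lift ord_max j.
      by apply: val_inj; rewrite /= /bump leqNgt jm leqNgt ltn_ord.
    rewrite (eq_bigr (fun d => arrow_weight u v w y d * y ^+ k (lift m j) *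
       (y * (x j / y) ^+ (k (lift m j) + ne_shift d)))) => [|d _].
      rewrite sum_arrow /= !shiftE !addn1 !addn0 !exprS exprMn exprVn mulr1 /pair_factor.
      by field; rewrite y0 expf_neq0.
    congr (_ * _); rewrite ej liftK /= ffunE jm.
    case: unliftP => [i ij|_]; rewrite /= ?mulr1 //.
    have {}ij : j = i.+1 :> nat by rewrite -(lift_max j) ij.
    by rewrite ffunE (ltn_trans _ jm) ?mulr1 // ij.
  have ej : lift m j = lift ord0 j by apply: val_inj; rewrite /= /bump jm.
  rewrite (eq_bigr (fun d => arrow_weight u v w y d * y ^+ k (lift m j) *
     (- (y * (x j / y) ^+ ((k (lift m j)).+1 - nw_shift d))))) => [|d _].
    rewrite sum_arrow /= !shiftE !subn1 !subn0 /= addn1 !exprS exprMn exprVn mulr1 /pair_factor.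
    by field; rewrite y0 x0 expf_neq0.
  congr (_ * _); rewrite ej liftK /= ffunE ltnNge jm /=.
  case: unliftP => [i ij|_]; rewrite /= ?mul1r //.
  have {}ij : i = j.+1 :> nat by rewrite -(lift_max i) -ij.
  by rewrite ffunE ltnNge ij (leq_trans jm) // mul1r.
rewrite (bigD1_ord m) //= at_m; under eq_bigr do rewrite at_lift.
rewrite !big_split /= {1}/operator_term [in RHS]/operator_term.
have mn : (m <= n)%N by rewrite -ltnS.
have -> : \prod_(i < n) (if (i < m)%N then y else -1) = y ^+ m * (-1) ^+ (m + n).
  rewrite -(big_mkord xpredT (fun i => if (i < m)%N then y else -1)).
  rewrite (big_cat_nat _ mn) //=; congr (_ * _).
    rewrite -[X in y ^+ X]subn0 -prodr_const_nat.
    by apply: eq_big_nat => i /andP[_ ->].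
  rewrite -signr_odd addnC oddD -oddB // signr_odd -prodr_const_nat.
  by apply: eq_big_nat => i /andP[mi _]; rewrite ltnNge mi.
have -> : \prod_(p < n.+1) \prod_(q < n.+1 | (p < q)%N)
      pair_factor (oapp x y (unlift m p)) (oapp x y (unlift m q)) =
    (\prod_(i < n) (if (m <= i)%N then pair_factor y (x i) else 1)) *
    ((\prod_(i < n) (if (i < m)%N then pair_factor (x i) y else 1)) *
     \prod_(p < n) \prod_(q < n | (p < q)%N) pair_factor (x p) (x q)).
  rewrite (bigD1_ord m) //= unlift_none big_mkcond (bigD1_ord m) //= ltnn mul1r.
  congr (_ * _); first by apply: eq_bigr => i _; rewrite m_lift liftK.
  rewrite -big_split; apply: eq_bigr => i _ /=; rewrite liftK.
  rewrite big_mkcond (bigD1_ord m) //= lift_m unlift_none /=; congr (_ * _).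
  by rewrite [RHS]big_mkcond; apply: eq_bigr => j _; rewrite lift_lt liftK.
rewrite [X in _ = _ * (_ * X)](bigD1_ord m) //= unlift_none /=.
have -> : \prod_(i < n) oapp x y (unlift m (lift m i)) ^+ (k (bump m i) + bump m i) =
    (\prod_(i < n) x i ^+ (0 + i)) * \prod_(i < n) x i ^+ (k (bump m i) + (m <= i)).
  rewrite -big_split; apply: eq_bigr => i _ /=.
  by rewrite liftK /= add0n -exprD; congr (_ ^+ _); rewrite /bump; lia.
rewrite (exprD y); set e := (-1) ^+ (m + n).
by ring.
Qed.

End LastVariable.

(** By the previous lemmas only the thresholds contribute, and threshold [m] gives
    the permutations that send [m] to the last variable. *)
Lemma operator_sum_recurrence n (k : nat -> nat) (X : nat -> F) : (forall i, (i <= n)%N -> X i != 0) ->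
  (u * X n + v * (X n)^-1 + w) * operator_sum n.+1 k X =
  \sum_(s : 'S_n) (-1) ^+ s * (operator_term (fun=> 0%N) (fun i => X (s i)) *
    \sum_c \prod_p endpoint_factor (X n) k c (fun i => X (s i)) p).
Proof.
move=> X0.
transitivity (\sum_(c : {ffun 'I_n -> bool}) \sum_(s : 'S_n) (-1) ^+ s *
  (operator_term (fun=> 0%N) (fun i => X (s i)) *
    \prod_p endpoint_factor (X n) k c (fun i => X (s i)) p)); last first.
  rewrite exchange_big; apply: eq_bigr => s _ /=.
  by rewrite !mulr_sumr.
rewrite sum_threshold => [|c [i [j [ji ci cj]]]]; last first.
  apply: (@antisym_sum_eq0 _ _ (tperm i j)).
    by rewrite odd_tperm -val_eqE /= ji ltn_eqF.
  move=> s; rewrite -(@endpoint_ascent_antisym n (X n) k _ c (fun p => X (s p)) i j) //; last 2 first.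
  - exact: X0.
  - by move=> p; apply: X0; apply: ltnW.
  rewrite (_ : (fun p => X ((tperm i j * s)%g p)) = fun p => X (s (tperm i j p))) //.
  by apply: functional_extensionality => p; rewrite permM.
rewrite /operator_sum (partition_big (fun s : 'S_n.+1 => (s^-1)%g ord_max) predT) //= mulr_sumr.
apply: eq_bigr => m _; rewrite mulr_sumr.
rewrite (eq_bigl (fun s : 'S_n.+1 => s m == ord_max)) => [|s]; last first.
  by rewrite (can2_eq (permKV s) (permK s)) eq_sym.
rewrite reindex_lift_perm; apply: eq_bigr => s _.
rewrite endpoint_threshold; last 2 first.
- exact: X0.
- by move=> p; apply: X0; apply: ltnW.
rewrite sign_lift_perm (_ : (fun i => X (lift_perm m ord_max s i)) =
    fun i => oapp (fun p => X (s p)) (X n) (unlift m i)).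
  by rewrite /=; move: (operator_term _ _) ((-1) ^+ s) ((-1) ^+ _) => T e1 e2; ring.
apply: functional_extensionality => i; case: unliftP => [j|] -> /=.
  by rewrite lift_perm_lift lift_max.
by rewrite lift_perm_id.
Qed.

(** One geometric sum for every entry of the last row but one; the product of the
    denominators [y - x i] does not depend on the arrows. *)
Lemma sum_interval_pow n N (y : F) (k : nat -> nat) (x : 'I_n -> F)
    (b : {ffun 'I_n.+1 -> arrow}) : y != 0 ->
    (forall i, (i < n)%N -> (k i < k i.+1)%N) -> (k n < N)%N ->
  (\prod_i (y - x i)) *
  \sum_(l : {ffun 'I_n -> 'I_N} |
        [forall j : 'I_n, (k j + ne_shift (b (lift ord_max j)) <= ext l j)%N &&
                          (ext l j + nw_shift (b (lift ord0 j)) <= k j.+1)%N])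
      y ^ ((\sum_(j < n.+1) k j)%N%:Z - (\sum_(j < n) ext l j)%N%:Z) *
      \prod_(i < n) x i ^+ ext l i
  = (\prod_(i < n.+1) y ^+ k i) * 
    \prod_(j < n) (y * (x j / y) ^+ (k j + ne_shift (b (lift ord_max j))) -
                   y * (x j / y) ^+ ((k j.+1).+1 - nw_shift (b (lift ord0 j)))).
Proof.
move=> y0 kS kN.
have kN' j : (j <= n)%N -> (k j < N)%N.
  move=> jn; rewrite -(subKn jn); elim: (n - j)%N (leq_subr j n) => [|d IH] dn.
    by rewrite subn0.
  apply: ltn_trans (IH (ltnW dn)); rewrite -(subnSK dn).
  by apply: kS; rewrite ltn_subrL (leq_ltn_trans _ dn).
pose hi (j : 'I_n) := ((k j.+1).+1 - nw_shift (b (lift ord0 j)))%N.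
pose lo (j : 'I_n) := (k j + ne_shift (b (lift ord_max j)))%N.
have hiN j : (hi j <= N)%N by apply: leq_trans (leq_subr _ _) (kN' _ (ltn_ord j)).
have shift1 d : (nw_shift d <= 1)%N && (ne_shift d <= 1)%N by case: d.
transitivity ((\prod_(i < n.+1) y ^+ k i) * ((\prod_i (y - x i)) *
   \sum_(l : {ffun 'I_n -> 'I_N} | [forall j : 'I_n, lo j <= l j < hi j]%N)
      \prod_(i < n) (x i / y) ^+ l i)).
  rewrite mulrCA; congr (_ * _); rewrite mulr_sumr; apply: eq_big => [l|l _].
    apply: eq_forallb => j; rewrite ext_ord; congr (_ && _).
    rewrite /hi; have /andP[] := shift1 (b (lift ord0 j)).
    case: (nw_shift _) => [|[|//]] _ _; first by rewrite addn0 subn0 ltnS.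
    by rewrite addn1 subn1.
  rewrite expfzDr // -exprnN -!exprnP !(big_morph (GRing.exp y) (exprD y) (expr0 y)).
  rewrite -mulrA -prodfV -big_split; congr (_ * _); apply: eq_bigr => i _ /=.
  by rewrite ext_ord exprMn exprVn mulrC.
congr (_ * _).
transitivity (\prod_i ((y - x i) * \sum_(l < N | (lo i <= l < hi i)%N) (x i / y) ^+ l)).
  rewrite big_split (bigA_distr_big_dep (fun i (l : 'I_N) => lo i <= l < hi i)%N).
  by congr (_ * _).
apply: eq_bigr => j _; rewrite (big_ord_interval (fun l => (x j / y) ^+ l)) // mulr_sumr.
rewrite (telescope_sumr_eq (fun l => - (y * (x j / y) ^+ l))) => [||l _].
- by rewrite opprK addrC.
- have /andP[_ h1] := shift1 (b (lift ord_max j)).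
  have /andP[h2 _] := shift1 (b (lift ord0 j)).
  move: h1 h2 (kS _ (ltn_ord j)); rewrite /lo /hi; clear.
  by move: (ne_shift _) (nw_shift _) => c d; lia.
by rewrite exprS; field.
Qed.

(** Induction on [n]: summing over the intervals to which the last row but one is
    confined turns the formula for [n] variables into the sum evaluated by
    [operator_sum_recurrence]. *)
Theorem amt_operator_formula n N (X : nat -> F) (k : nat -> nat) :
    (forall i, (i < n)%N -> X i != 0) ->
    (forall i, (i.+1 < n)%N -> (k i < k i.+1)%N) -> (forall i, (i < n)%N -> (k i < N)%N) ->
  (\prod_(i < n) \prod_(j < n | (i < j)%N) (X j - X i)) * amt_sum u v w N X n k
  = (\prod_(i < n) (u * X i + v * (X i)^-1 + w)) * operator_sum n k X.
Proof.
elim: n k => [|n IH] k X0 kS kN.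
  rewrite !big_ord0 !mul1r /operator_sum /amt_sum.
  have no (T : Type) (c : triangle 0) : T by case: c => -[].
  rewrite (big_pred1 [ffun c => no _ c]) => [|m]; last by apply/esym/eqP/ffunP => c; apply: no.
  rewrite (big_pred1 [ffun c => no _ c]) => [|a]; last first.
    transitivity true; last by apply/esym/eqP/ffunP => c; apply: no.
    have all0 (p : pred (triangle 0)) : [forall c, p c] by apply/forallP => c; apply: no.
    by rewrite /is_amt /monotone_triangle /arrowed /bottom_row !all0.
  rewrite (big_pred1 1%g) => [|s]; last by apply/esym/eqP/permP => -[].
  rewrite /amt_weight /operator_term !big_ord0 odd_perm1 /arrow_count !eq_card0 ?mulr1 // => c; exact: no _ c.
have Xn0 : X n != 0 by apply: X0.
have kn : (k n < N)%N by apply: kN.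
rewrite amt_sum_recurrence //.
set A := fun (b : {ffun 'I_n.+1 -> arrow}) (l : {ffun 'I_n -> 'I_N}) => [forall j : 'I_n,
  (k j + ne_shift (b (lift ord_max j)) <= ext l j)%N &&
  (ext l j + nw_shift (b (lift ord0 j)) <= k j.+1)%N].
set C := \prod_(i < n) (u * X i + v * (X i)^-1 + w).
set D := \prod_(i < n) (X n - X i).
pose Y (l : {ffun 'I_n -> 'I_N}) := X n ^ ((\sum_(j < n.+1) k j)%N%:Z - (\sum_(j < n) ext l j)%N%:Z).
pose W (b : {ffun 'I_n.+1 -> arrow}) := \prod_j arrow_weight u v w (X n) (b j).
transitivity (\sum_b \sum_(l | A b l) \sum_(s : 'S_n) C * D * W b * Y l * (-1) ^+ s *
    (operator_term (fun=> 0%N) (fun i => X (s i)) * \prod_(i < n) X (s i) ^+ ext l i)).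
  rewrite (prod_lt_recr n (fun i j => X j - X i)) mulr_sumr; apply: eq_bigr => b _.
  rewrite !mulr_sumr; apply: eq_bigr => l /forallP Al.
  transitivity (D * W b * Y l * (C * operator_sum n (ext l) X)).
    rewrite -IH.
    - by rewrite /D /W /Y; ring.
    - by move=> i ni; apply: X0; apply: ltnW.
    - move=> i ni; have /andP[_ h1] := Al (Ordinal (ltnW ni)).
      have /andP[h2 _] := Al (Ordinal ni).
      rewrite (_ : lift ord_max (Ordinal ni) = lift ord0 (Ordinal (ltnW ni))) in h2; last first.
        by apply/val_inj/lift_max.
      by move: h1 h2 => /=; case: (b _); rewrite ?shiftE; lia.
    - by move=> i ni; rewrite -[i]/(nat_of_ord (Ordinal ni)) ext_ord.
  transitivity (C * D * W b * Y l * operator_sum n (ext l) X); first by ring.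
  rewrite mulr_sumr; apply: eq_bigr => s _.
  have -> : operator_term (ext l) (fun i => X (s i)) =
      operator_term (fun=> 0%N) (fun i => X (s i)) * \prod_(i < n) X (s i) ^+ ext l i.
    rewrite /operator_term -mulrA; congr (_ * _); rewrite -big_split; apply: eq_bigr => i _ /=.
    by rewrite -exprD addnC.
  by rewrite !mulrA.
rewrite big_ord_recr -mulrA operator_sum_recurrence; last by move=> i ni; apply: X0.
rewrite mulr_sumr; under eq_bigr do rewrite exchange_big.
rewrite exchange_big; apply: eq_bigr => s _ /=.
rewrite -sum_arrow_endpoints // !mulr_sumr; apply: eq_bigr => b _.
rewrite big_split /= -/(W b) -(mulrA (W b)).
have /= <- // := @sum_interval_pow n N (X n) k (fun i => X (s i)) b Xn0 _ kn.
rewrite !mulr_sumr; apply: eq_bigr => l _.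
rewrite (_ : \prod_i (X n - X (s i)) = D); last first.
  by rewrite /D [RHS](reindex_perm s).
rewrite -/(Y l) -/C; move: (operator_term _ _) (\prod_(i < n) X (s i) ^+ _) => T P.
move: C D (W b) (Y l) ((-1) ^+ s) => C' D' W' Y' e.
by ring.
Qed.

End OperatorFormula.

(** * Comparison of the two sides *)

(** A permutation acts on unordered pairs. *)
Lemma prod_lt_perm (R : comPzSemiRingType) n (s : 'S_n) (f : 'I_n -> 'I_n -> R) :
  (forall i j, f i j = f j i) ->
  \prod_(p < n) \prod_(q < n | (p < q)%N) f (s p) (s q) =
  \prod_(p < n) \prod_(q < n | (p < q)%N) f p q.
Proof.
move=> fC; rewrite !pair_big_dep /=.
(* [o] sorts a pair; [h t] is the action of [t] on sorted pairs. *)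
pose o (pq : 'I_n * 'I_n) := if (pq.1 < pq.2)%N then pq else (pq.2, pq.1).
pose h (t : 'S_n) (pq : 'I_n * 'I_n) := o (t pq.1, t pq.2).
have hK (t t' : 'S_n) (pq : 'I_n * 'I_n) : cancel t t' -> (pq.1 < pq.2)%N -> h t' (h t pq) = pq.
  case: pq => p q tK /= lt_pq; rewrite /h /o /=; case: (ltnP (t p) (t q)) => _ /=; rewrite !tK ?lt_pq //.
  by rewrite ltnNge (ltnW lt_pq).
have h_lt (t : 'S_n) (pq : 'I_n * 'I_n) : (pq.1 < pq.2)%N -> ((h t pq).1 < (h t pq).2)%N.
  case: pq => p q /= lt_pq; rewrite /h /o /=; case: (ltngtP (t p) (t q)) => //= e.
  by rewrite (perm_inj (val_inj e)) ltnn in lt_pq.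
rewrite [RHS](reindex_onto (h s) (h s^-1%g)) /=; last first.
  by move=> pq; apply: hK; apply: permKV.
apply: eq_big => [[p q] /=|[p q] /= pq]; last by rewrite /h /o /=; case: ifP.
apply/idP/idP => [lt_pq|/andP[lt /eqP e]].
  by rewrite (h_lt s (p, q)) //= (hK s s^-1%g (p, q)) //; apply: permK.
by have := h_lt s^-1%g _ lt; rewrite e.
Qed.

Lemma prod_lt_rev (R : comPzSemiRingType) n (f : 'I_n -> 'I_n -> R) :
  \prod_(p < n) \prod_(q < n | (p < q)%N) f (rev_ord p) (rev_ord q) =
  \prod_(p < n) \prod_(q < n | (p < q)%N) f q p.
Proof.
rewrite (reindex_inj rev_ord_inj) /=.
under eq_bigr do rewrite (reindex_inj rev_ord_inj) /=.
rewrite (exchange_big_dep predT) //=; apply: eq_bigr => p _.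
apply: eq_big => [q|q _]; last by rewrite !rev_ordK.
by rewrite /= ltn_sub2lE // ltnS.
Qed.

Lemma prod_lt_left (R : comPzSemiRingType) n (x : 'I_n -> R) :
  \prod_(p < n) \prod_(q < n | (p < q)%N) x p = \prod_(p < n) x p ^+ (n - p.+1).
Proof.
apply: eq_bigr => p _; rewrite -prodr_const_nat -(big_ord_interval _ (leqnn n)).
by apply: eq_bigl => q; rewrite ltn_ord andbT.
Qed.

Lemma prod_lt_right (R : comPzSemiRingType) n (x : 'I_n -> R) :
  \prod_(p < n) \prod_(q < n | (p < q)%N) x q = \prod_(q < n) x q ^+ q.
Proof.
rewrite (exchange_big_dep predT) //=; apply: eq_bigr => q _.
rewrite -[X in _ ^+ X]subn0 -prodr_const_nat -(big_ord_interval _ (ltnW (ltn_ord q))).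
by [].
Qed.

Section RowReversal.
Variables (F : fieldType) (n : nat).
Definition rev_perm : 'S_n := perm (@rev_ord_inj n).

Lemma det_rev_rows (f : nat -> 'I_n -> F) :
  \det (\matrix_(i < n, j < n) f (n - i)%N j) =
  (-1) ^+ rev_perm * \det (\matrix_(i < n, j < n) f i.+1 j).
Proof.
rewrite -det_perm -det_mulmx -row_permE; congr (\det _); apply/matrixP => i j.
by rewrite !mxE permE /= subnSK.
Qed.

(** Both sides are Vandermonde determinants, of [c] in reverse order and of [c]. *)
Lemma prod_lt_sub_rev (c : 'I_n -> F) :
  \prod_(i < n) \prod_(j < n | (i < j)%N) (c i - c j) =
  (-1) ^+ rev_perm * \prod_(i < n) \prod_(j < n | (i < j)%N) (c j - c i).
Proof.
have V (d : 'I_n -> F) : \det (Vandermonde n (\row_i d i)) =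
    \prod_(i < n) \prod_(j < n | (i < j)%N) (d j - d i).
  rewrite det_Vandermonde; apply: eq_bigr => i _; apply: eq_bigr => j _.
  by rewrite !mxE.
rewrite -(prod_lt_rev (fun i j => c j - c i)) -(V (fun i => c (rev_ord i))) -V.
rewrite mulrC -det_perm -(det_tr (perm_mx _)) -det_mulmx; congr (\det _).
rewrite tr_perm_mx -col_permE; apply/matrixP => i j.
by rewrite !mxE permE.
Qed.
End RowReversal.

Section Comparison.
Variables (F : fieldType) (n : nat) (u v w : F) (X : nat -> F).
Hypothesis v0 : v != 0.
Hypothesis w0 : w != 0.
Hypothesis X0 : forall i, (i < n)%N -> X i != 0.
Hypothesis X_inj : forall i j, (i < j)%N -> (j < n)%N -> X i != X j.
Hypothesis uXX : forall i j, (i < n)%N -> (j < n)%N -> u * X i * X j != v.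

Let x i := u * X i.
Let x' i := v * (X i)^-1.
Let a i := x i * (w + x i).
Let a' i := x' i * (w + x' i).

(** For each pair, [pair_factor x_p x_q * (u - v / (x_p x_q))] equals
    [(a_q - a'_p) x_p / x_q^2]; the powers of the variables left over add up to
    [n - 1] for each of them. *)
Lemma operator_term_even (s : 'S_n) :
  (\prod_(i < n) (x i - x' i)) *
  (\prod_(i < n) \prod_(j < n | (i < j)%N) (u - v * (X i * X j)^-1)) *
  (\prod_(i < n) (u * X i + v * (X i)^-1 + w)) *
  operator_term u v w (fun j => 2 * j)%N (fun i : 'I_n => X (s i))
  = (\prod_(i < n) X i ^+ n.-1) *
    \prod_(q < n) \prod_(p < n | (p <= q)%N) (a (s q) - a' (s p)).
Proof.
rewrite -(prod_lt_perm s (f := fun i j => u - v * (X i * X j)^-1)); last first.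
  by move=> i j; rewrite (mulrC (X i)).
rewrite (reindex_perm s) /= [X in _ * _ * X * _](reindex_perm s) /=.
rewrite [X in _ = X * _](reindex_perm s) /=.
set y := fun i => X (s i).
have y0 i : y i != 0 by apply: X0.
have -> : \prod_(q < n) \prod_(p < n | (p <= q)%N) (a (s q) - a' (s p)) =
    (\prod_(q < n) (a (s q) - a' (s q))) *
    \prod_(p < n) \prod_(q < n | (p < q)%N) (a (s q) - a' (s p)).
  rewrite [X in _ = _ * X](exchange_big_dep predT) //= -big_split; apply: eq_bigr => q _ /=.
  rewrite (bigD1 q) //=; congr (_ * _); apply: eq_bigl => p.
  by rewrite ltn_neqAle andbC -val_eqE.
have -> : \prod_(q < n) (a (s q) - a' (s q)) = (\prod_(i < n) (x (s i) - x' (s i))) *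
    \prod_(i < n) (u * X (s i) + v * (X (s i))^-1 + w).
  by rewrite -big_split; apply: eq_bigr => i _ /=; rewrite /a /a' /x /x'; ring.
have pairs : \prod_(p < n) \prod_(q < n | (p < q)%N) (u - v * (y p * y q)^-1) *
    (\prod_(p < n) \prod_(q < n | (p < q)%N) pair_factor u v w (y p) (y q)) *
    \prod_(q < n) (y q ^+ 2) ^+ q =
    (\prod_(p < n) y p ^+ (n - p.+1)) *
    \prod_(p < n) \prod_(q < n | (p < q)%N) (a (s q) - a' (s p)).
  rewrite -prod_lt_right -prod_lt_left -!big_split; apply: eq_bigr => p _ /=.
  rewrite -!big_split; apply: eq_bigr => q _ /=.
  rewrite /pair_factor /a /a' /x /x' -/(y p) -/(y q); field.
  by rewrite !y0.
have -> : \prod_(i < n) y i ^+ n.-1 = (\prod_(p < n) y p ^+ (n - p.+1)) * \prod_(i < n) y i ^+ i.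
  rewrite -big_split; apply: eq_bigr => i _ /=; rewrite -exprD; congr (_ ^+ _).
  by have := ltn_ord i; clear; lia.
have e3 : \prod_(i < n) y i ^+ (2 * i + i) = (\prod_(q < n) (y q ^+ 2) ^+ q) * \prod_(i < n) y i ^+ i.
  by rewrite -big_split; apply: eq_bigr => i _ /=; rewrite exprD exprM.
rewrite /operator_term e3 {e3}.
move: pairs; set S := \prod_p \prod_(q | _) (u - _); set G := \prod_p \prod_(q | _) pair_factor _ _ _ _ _.
set A := \prod_p \prod_(q | _) (_ - _); set P2 := \prod_q (_ ^+ 2) ^+ _.
set Pn := \prod_p _ ^+ (n - _); set P1 := \prod_i _ ^+ _.
set T := \prod_j (x _ - _); set B := \prod_j (_ + w).
move: S G A P2 Pn P1 T B => S G A P2 Pn P1 T B pairs.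
transitivity (T * B * P1 * (S * G * P2)); first by ring.
by rewrite pairs; ring.
Qed.

Let c i := x i + x' i.

(** [c_j - c_i = (X_j - X_i) (u - v / (X_i X_j))]. *)
Lemma prod_sub_c :
  \prod_(i < n) \prod_(j < n | (i < j)%N) (c j - c i) =
  (\prod_(i < n) \prod_(j < n | (i < j)%N) (X j - X i)) *
  \prod_(i < n) \prod_(j < n | (i < j)%N) (u - v * (X i * X j)^-1).
Proof.
rewrite -big_split; apply: eq_bigr => i _; rewrite -big_split; apply: eq_bigr => j _ /=.
by rewrite /c /x /x'; field; rewrite !X0.
Qed.

Lemma amt_gf_det :
  (\prod_(i < n) (x i - x' i)) *
  (\prod_(i < n) \prod_(j < n | (i < j)%N) (c j - c i)) *
  amt_gf u v w (fun i : 'I_n => X i)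
  = (\prod_(i < n) X i ^+ n.-1) *
    \det (\matrix_(i < n, j < n) (a j ^+ i.+1 - a' j ^+ i.+1)).
Proof.
have -> : amt_gf u v w (fun i : 'I_n => X i) = amt_sum u v w n.*2 X n (fun j => 2 * j)%N by [].
rewrite prod_sub_c -mulrA [X in _ * X]mulrAC amt_operator_formula //; last 2 first.
- by move=> i _; rewrite ltn_pmul2l.
- by move=> i ni; rewrite -mul2n ltn_pmul2l.
rewrite -(antisym_prod_sub (fun i : 'I_n => a i) (fun i : 'I_n => a' i)) /operator_sum !mulr_sumr.
rewrite mulr_suml mulr_sumr; apply: eq_bigr => s _.
rewrite [RHS]mulrCA -operator_term_even.
move: (operator_term _ _ _ _ _) ((-1) ^+ s) => O e.
set T := \prod_(i < n) (x i - _); set S := \prod_(i < n) \prod_(j < n | _) _.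
set B := \prod_(i < n) (_ + w).
by move: T S B => T S B; ring.
Qed.

Lemma iter_shift_op (b b' : F) k e :
  iter k (shift_op w) (fun e => b ^+ e - b' ^+ e) e =
  (b * (w + b)) ^+ k * b ^+ e - (b' * (w + b')) ^+ k * b' ^+ e.
Proof.
elim: k e => [|k IH] e; first by rewrite !mul1r.
by rewrite iterS /shift_op !IH !exprS; ring.
Qed.

Lemma pp_gf_det :
  (\prod_(i < n) (x i - x' i)) *
  (\prod_(i < n) \prod_(j < n | (i < j)%N) (c i - c j)) *
  pp_gf u v w (fun i : 'I_n => X i)
  = (\prod_(i < n) X i ^+ n.-1) *
    \det (\matrix_(i < n, j < n) (a j ^+ (n - i) - a' j ^+ (n - i))).
Proof.
rewrite pp_gf_fill_sum //.
transitivity ((\prod_(i < n) X i ^+ n.-1) *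
  \sum_(lam : {ffun 'I_n -> 'I_n.+1} | decreasing n (ext lam))
    vstrip_sum n w n (ext lam) * \det (bialternant n x x' (ext lam))); last first.
  congr (_ * _).
  rewrite (sum_vstrip_sum_det w (fun (j : 'I_n) e => x j ^+ e - x' j ^+ e) (leqnn n)).
  congr (\det _); apply/matrixP => i j; rewrite !mxE iter_shift_op.
  by rewrite !mulr1.
set T := \prod_(i < n) (x i - x' i); set V := \prod_(i < n) \prod_(j < n | _) _.
set K := \prod_(i < n) X i ^+ n.-1.
transitivity (K * (T * V * (w ^+ 'C(n.+1, 2) *
  \sum_(lam : {ffun 'I_n -> 'I_n.+1} | decreasing n (ext lam))
    w ^- (\sum_(i < n) ext lam i) *
    fill_sum false true n n (2 * n) (fun i => (n - i).*2) (alternate x x') (ext lam) *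
    fill_sum true false n n n (fun i => n - i)%N (fun=> 1) (ext lam)))).
  by move: (\sum_(_ | _) _) => S; move: T V K => T V K; ring.
congr (_ * _); rewrite !mulr_sumr; apply: eq_bigr => lam /forallP dec.
have dec' i : (ext lam i.+1 <= ext lam i)%N.
  by apply: ext_decreasing => k kn; apply: (dec (Ordinal kn)).
have vs := vstrip_fill_sum (M := n) w (leqnn n) (leqnn n) dec' (ext_bound _ _) (ext_out _ (leqnn n)).
have sp : T * V * fill_sum false true n n (2 * n) (fun i => (n - i).*2) (alternate x x') (ext lam)
    = \det (bialternant n x x' (ext lam)).
  apply: symplectic_fill_sum => //.
  - by rewrite mul2n.
  - by move=> i j ni nj; rewrite /x /x'; field; rewrite !X0.
  - by move=> i ni; rewrite /x' mulf_neq0 // invr_neq0 // X0.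
  - move=> i j ni nj; rewrite /x /x' -(inj_eq (mulIf (X0 nj))) divfK ?X0 //.
    exact: uXX.
  - move=> i j ij nj; rewrite /x' (inj_eq (mulfI v0)) (inj_eq invr_inj) eq_sym.
    exact: X_inj.
  - move=> i j ij nj; have ni := ltn_trans ij nj.
    rewrite -subr_eq0 (_ : _ - _ = (X i - X j) * (u * X i * X j - v) / (X i * X j)); last first.
      by rewrite /x /x'; field; rewrite !X0.
    by rewrite !mulf_neq0 ?invr_neq0 ?mulf_neq0 ?subr_eq0 ?X0 ?X_inj ?uXX.
  - exact: ext_bound.
  - exact: ext_out.
move: sp vs; set W := w ^+ (\sum_(i < n) _); set fp := fill_sum _ _ _ _ _ _ _ _.
set fq := fill_sum _ _ _ _ _ _ _ _; set z := vstrip_sum _ _ _ _ => <- vs.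
have W0 : W != 0 by rewrite expf_neq0.
transitivity (T * V * fp * (w ^+ 'C(n.+1, 2) * fq / W)).
  by rewrite -/x -/x'; move: T V fp fq W (w ^+ _) {vs W0} => T V fp fq W wC; ring.
by rewrite -vs mulfK // mulrC.
Qed.

Theorem amt_gf_eq_pp_gf :
  amt_gf u v w (fun i : 'I_n => X i) = pp_gf u v w (fun i : 'I_n => X i).
Proof.
have T0 : \prod_(i < n) (x i - x' i) != 0.
  apply/prodf_neq0 => i _; rewrite subr_eq0 -(inj_eq (mulIf (X0 (ltn_ord i)))).
  by rewrite divfK ?X0 // uXX.
have V0 : \prod_(i < n) \prod_(j < n | (i < j)%N) (c j - c i) != 0.
  apply/prodf_neq0 => i _; apply/prodf_neq0 => j ij.
  rewrite (_ : c j - c i = (X j - X i) * (u * X i * X j - v) / (X i * X j)); last first.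
    by rewrite /c /x /x'; field; rewrite !X0.
  by rewrite !mulf_neq0 ?invr_neq0 ?mulf_neq0 ?subr_eq0 ?X0 ?uXX // eq_sym X_inj.
apply: (mulfI (mulf_neq0 T0 V0)); rewrite amt_gf_det.
have := pp_gf_det; rewrite (prod_lt_sub_rev (fun i : 'I_n => c i)).
rewrite (det_rev_rows (fun k (j : 'I_n) => a j ^+ k - a' j ^+ k)).
(* The sign [e] of the reversal appears both in the determinant and in the
   Vandermonde product, and cancels. *)
set V := \prod_(i < n) \prod_(j < n | _) _; set e := (-1) ^+ rev_perm n.
have e0 : e != 0 by rewrite expf_neq0 // oppr_eq0 oner_eq0.
move=> h; apply: (mulfI e0); rewrite mulrCA -h.
by move: (pp_gf _ _ _ _) => S; rewrite /=; ring.
Qed.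

End Comparison.

(** * Specialization to indeterminates *)

Lemma indet_neq n (p q : {mpoly int[3 + n]}) (i : 'I_(3 + n)) :
  p.@[fun k => if k == i then 0 else 1] != q.@[fun k => if k == i then 0 else 1] ->
  tofrac p != tofrac q.
Proof. by move=> h; rewrite tofrac_eq; apply: contraNneq h => ->. Qed.

Lemma indet_neq0 n (i : 'I_(3 + n)) : indet i != 0.
Proof.
rewrite /indet -tofrac0 tofrac_eq; apply/eqP => /(congr1 (meval (fun=> 1))).
by rewrite mevalXU meval0.
Qed.

Lemma indet_inj n : injective (@indet n).
Proof.
move=> i j eij; apply/eqP/negPn/negP => nij.
have := @indet_neq n 'X_i 'X_j i; rewrite !mevalXU eqxx [j == i]eq_sym (negbTE nij).
by rewrite -[tofrac 'X_i]/(indet i) eij eqxx => /(_ isT).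
Qed.

Theorem theorem2p2 (n : nat) (hn : (1 <= n)%N) :
  amt_gf (uvar n) (vvar n) (wvar n) (@Xvar n)
  = pp_gf (uvar n) (vvar n) (wvar n) (@Xvar n).
Proof.
pose X k : ratfun n := if insub k is Some i then Xvar i else 0.
have XE (i : 'I_n) : X i = Xvar i by rewrite /X valK.
have -> : @Xvar n = fun i : 'I_n => X i.
  by apply: functional_extensionality => i.
apply: amt_gf_eq_pp_gf.
- exact: indet_neq0.
- exact: indet_neq0.
- by move=> i ni; rewrite (XE (Ordinal ni)); apply: indet_neq0.
- move=> i j ij nj; rewrite (XE (Ordinal (ltn_trans ij nj))) (XE (Ordinal nj)).
  rewrite /Xvar (inj_eq (@indet_inj n)) (inj_eq (@rshift_inj _ _)) -val_eqE /=.
  by rewrite ltn_eqF.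
move=> i j ni nj; rewrite (XE (Ordinal ni)) (XE (Ordinal nj)).
rewrite /Xvar /uvar /vvar /indet -!rmorphM /=.
apply: (@indet_neq _ _ _ (lshift n (@Ordinal 3 0 isT))).
rewrite !mevalM !mevalXU eqxx.
by rewrite !mul0r.
Qed.
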